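(* Let $1<\alpha<2$ and $t>0$. Let $\tau$ be a Young function satisfying $\tau(y)=y^2\psi(y)$ for some positive and non-decreasing function $\psi$ going to $+\infty$ at infinity. Assume also that there exists a constant $k(\psi)$ such that $\psi(2y)\le k(\psi)\psi(y)$. Then for any integer $n\ge 1$, $\mathbf P_t^\alpha(e^{U_\alpha})$ belongs to $L_\tau(\nu_\alpha)$ (where $\nu_\alpha$ is the Boltzmann measure on $\mathbb R^n$) if there exists some constant $d_\alpha<\alpha^2$ such that $$\int^{+\infty}\psi\big(e^{|x|^\alpha}\big)\,e^{-d_\alpha t|x|^{2(\alpha-1)}}\,dx<+\infty .$$
   Context: Let $u_\alpha:\mathbb R\to\mathbb R$ be the $C^2$ convex function $u_\alpha(x)=|x|^\alpha$ for $|x|>1$ and $u_\alpha(x)=\frac{\alpha(\alpha-2)}{8}x^4+\frac{\alpha(4-\alpha)}{4}x^2+\left(1-\frac34\alpha+\frac18\alpha^2\right)$ for $|x|\le1$. On $\mathbb R^n$ put $U_\alpha(x)=\sum_{i=1}^nu_\alpha(x_i)$ and $\nu_\alpha(dx)=Z_\alpha^{-1}e^{-2U_\alpha(x)}dx$, a probability measure ($Z_\alpha$ is the normalizing constant). $(\mathbf P_t^\alpha)_{t\ge0}$ is the $\nu_\alpha$-symmetric semigroup generated by $A_\alpha=\frac12\Delta-\nabla U_\alpha\cdot\nabla$; it is given (also for non-negative measurable $h$) by $$(\mathbf P_t^\alpha h)(x)=e^{U_\alpha(x)}\,\mathbb E^{\mathbb P_x}\left[h(X_t)e^{-U_\alpha(X_t)}M_t\right],\qquad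 M_t=\exp\left(\frac12\int_0^t\big(\Delta U_\alpha-|\nabla U_\alpha|^2\big)(X_s)\,ds\right),$$ where under $\mathbb P_x$, $X$ is an $n$-dimensional Brownian motion started at $x$. $L_\tau(\nu_\alpha)$ is the set of measurable $f$ with $\int\tau(f)\,d\nu_\alpha<\infty$. A Young function is a continuous, even, convex function vanishing at $0$. The notation $\int^{+\infty}$ means integrability in a neighbourhood of $+\infty$ on the real line. *)

(* Defs.v *)
(* R^n is the type 'rV[R]_n of row vectors over a realType R. *)
From HB Require Import structures.
From mathcomp Require Import all_boot all_order all_algebra.
From mathcomp Require Import all_classical all_reals all_analysis.
From mathcomp Require Import measurable_realfun.

Set Implicit Arguments.
Unset Strict Implicit.
Unset Printing Implicit Defensive.

Import Order.TTheory GRing.Theory Num.Theory.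
Import numFieldNormedType.Exports.

Local Open Scope classical_set_scope.
Local Open Scope ring_scope.

(* The Borel sigma-algebra of R^n, presented as the one generated by the
   coordinate maps. *)
Section measurable_rV.
Context {R : realType} (n : nat).

Let coords (i : 'I_n) (x : 'rV[R]_n) : R := x ord0 i.

Let rV_set0 : g_sigma_preimage coords set0.
Proof. exact: sigma_algebra0. Qed.

Let rV_setC A : g_sigma_preimage coords A -> g_sigma_preimage coords (~` A).
Proof. exact: sigma_algebraC. Qed.

Let rV_bigcup (F : _^nat) : (forall i, g_sigma_preimage coords (F i)) ->
  g_sigma_preimage coords (\bigcup_i (F i)).
Proof. exact: sigma_algebra_bigcup. Qed.

Definition rV_display : measure_display := measure_tuple_display default_measure_display.

HB.instance Definition _ := @isMeasurable.Build rV_display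
  'rV[R]_n (g_sigma_preimage coords) rV_set0 rV_setC rV_bigcup.

End measurable_rV.

Lemma measurable_coord {R : realType} n (i : 'I_n) :
  measurable_fun [set: 'rV[R]_n] (fun x => x ord0 i).
Proof.
move=> _ Y mY; rewrite setTI; apply: sub_sigma_algebra => /=.
rewrite -bigcup_seq/=; exists i => /=; first by rewrite mem_index_enum.
by exists Y => //; rewrite setTI.
Qed.

Lemma measurable_fun_rV d (T : measurableType d) {R : realType} n
    (f : T -> 'rV[R]_n) :
  (forall i, measurable_fun setT (fun w => f w ord0 i)) -> measurable_fun setT f.
Proof.
move=> mf; suff H : forall A, measurable A -> measurable (f @^-1` A).
  by move=> _ A mA; rewrite setTI; exact: H.
apply: smallest_sub.
  split; first by rewrite /= preimage_set0.
  - by move=> A /= mA; rewrite setTD preimage_setC; exact: measurableC.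
  - by move=> F /= mF; rewrite preimage_bigcup; exact: bigcup_measurable.
rewrite -bigcup_seq; apply: bigcup_sub => i _ _ [B mB <-] /=.
by rewrite setTI -[X in measurable X]setTI; exact: mf.
Qed.

(* Lebesgue measure on R^n, by induction on n through R^(n+1) = R x R^n. *)
Section lebesgue_rV.
Context {R : realType}.

Definition rV_cons n (p : R * 'rV[R]_n) : 'rV[R]_n.+1 :=
  \row_i if unlift ord0 i is Some j then p.2 ord0 j else p.1.

Definition rV_uncons n (x : 'rV[R]_n.+1) : R * 'rV[R]_n :=
  (x ord0 ord0, \row_i x ord0 (lift ord0 i)).

Lemma rV_consK n : cancel (@rV_cons n) (@rV_uncons n).
Proof.
case=> a v; rewrite /rV_uncons /rV_cons mxE unlift_none; congr pair.
by apply/rowP => i; rewrite !mxE liftK.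
Qed.

Lemma rV_unconsK n : cancel (@rV_uncons n) (@rV_cons n).
Proof.
by move=> x; apply/rowP => i; rewrite mxE; case: unliftP => [j|] -> /=;
  rewrite ?mxE.
Qed.

Lemma measurable_rV_cons n : measurable_fun setT (@rV_cons n).
Proof.
apply: measurable_fun_rV => i; under eq_fun do rewrite mxE.
case: unliftP => [j|] _; last exact: measurable_fst.
by apply: (measurableT_comp (measurable_coord j)); exact: measurable_snd.
Qed.

Lemma measurable_rV_uncons n : measurable_fun setT (@rV_uncons n).
Proof.
apply: measurable_fun_pair; first exact: measurable_coord.
apply: measurable_fun_rV => i; under eq_fun do rewrite mxE.
exact: measurable_coord.
Qed.

Section step.
Context n (mu : {sigma_finite_measure set 'rV[R]_n -> \bar R}).

Definition lebesgue_rV_step : set 'rV[R]_n.+1 -> \bar R :=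
  pushforward (lebesgue_measure \x mu)%E (@rV_cons n).

Let mcons (A : set 'rV[R]_n.+1) : measurable A ->
  measurable (@rV_cons n @^-1` A).
Proof.
by move=> mA; rewrite -[X in measurable X]setTI; exact: measurable_rV_cons.
Qed.

Let step0 : lebesgue_rV_step set0 = 0%E.
Proof. by rewrite /lebesgue_rV_step /pushforward preimage_set0 measure0. Qed.

Let step_ge0 A : (0 <= lebesgue_rV_step A)%E.
Proof. by apply: integral_ge0 => x _; exact: measure_ge0. Qed.

Let step_sigma_additive : semi_sigma_additive lebesgue_rV_step.
Proof.
move=> F mF tF mUF; rewrite /lebesgue_rV_step /pushforward preimage_bigcup.
apply: measure_semi_sigma_additive.
- by move=> k; exact: mcons.
- apply/trivIsetP => /= i j _ _ ij; rewrite -preimage_setI.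
  by move/trivIsetP : tF => /(_ _ _ _ _ ij) ->//; rewrite preimage_set0.
- by rewrite -preimage_bigcup; exact: mcons.
Qed.

HB.instance Definition _ := isMeasure.Build _ _ _
  lebesgue_rV_step step0 step_ge0 step_sigma_additive.

Let lebesgue_rV_step_sigma_finite : sigma_finite setT lebesgue_rV_step.
Proof.
have /sigma_finiteP[F [TF ndF Foo]] := sigma_finiteT (@lebesgue_measure R).
have /sigma_finiteP[G [TG ndG Goo]] := sigma_finiteT mu.
exists (fun k => @rV_uncons n @^-1` (F k `*` G k)).
  apply/esym/seteqP; split=> // x _.
  have [i _ Fi] : (\bigcup_i F i) (rV_uncons x).1 by rewrite -TF.
  have [j _ Gj] : (\bigcup_j G j) (rV_uncons x).2 by rewrite -TG.
  exists (maxn i j) => //; split=> /=.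
  - by move: Fi; exact/subsetPset/ndF/leq_maxl.
  - by move: Gj; exact/subsetPset/ndG/leq_maxr.
move=> k; have [mF Fk] := Foo k; have [mG Gk] := Goo k; split.
  rewrite -[X in measurable X]setTI.
  by apply: measurable_rV_uncons => //; exact: measurableX.
rewrite /lebesgue_rV_step /pushforward -comp_preimage.
rewrite (_ : _ \o _ = id); last by apply/funext => p; exact: rV_consK.
by rewrite preimage_id product_measure1E// lte_mul_pinfty// ge0_fin_numE.
Qed.

HB.instance Definition _ := Measure_isSigmaFinite.Build _ _ _
  lebesgue_rV_step lebesgue_rV_step_sigma_finite.

End step.

Fixpoint lebesgue_rV n : {sigma_finite_measure set 'rV[R]_n -> \bar R} :=
  match n with
  | 0 => \d_(0 : 'rV[R]_0)
  | m.+1 => lebesgue_rV_step (lebesgue_rV m)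
  end.

End lebesgue_rV.

(* The value on boxes, which characterizes Lebesgue measure on R^n. *)
Lemma lebesgue_rV_box {R : realType} n (A : 'I_n -> set R) :
  (forall i, measurable (A i)) ->
  lebesgue_rV n [set x | forall i, A i (x ord0 i)] =
    (\prod_(i < n) lebesgue_measure (A i))%E.
Proof.
elim: n A => [|n IH] A mA.
  by rewrite big_ord0 /= diracE mem_set// => -[].
have mB : measurable
    [set x : 'rV[R]_n | forall i, A (lift ord0 i) (x ord0 i)].
  rewrite (_ : mkset _ = \big[setI/setT]_(i < n)
      ((fun x : 'rV[R]_n => x ord0 i) @^-1` A (lift ord0 i))).
    apply: bigsetI_measurable => i _.
    by rewrite -[X in measurable X]setTI; exact: measurable_coord.
  by rewrite -bigcap_seq; apply/seteqP; split=> x /= H i => [_|];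
    apply: H => //=; rewrite mem_index_enum.
rewrite big_ord_recl -IH//= -product_measure1E//; last exact: mA.
rewrite /lebesgue_rV_step /pushforward.
congr (product_measure1 _ _ _); apply/seteqP; split=> -[a v] /=.
  move=> Aav; split=> [|i].
    by have := Aav ord0; rewrite /rV_cons mxE unlift_none.
  by have := Aav (lift ord0 i); rewrite /rV_cons mxE liftK.
move=> [Aa Av] i; rewrite /rV_cons mxE.
by case: unliftP => [j|] ->.
Qed.

(* Partial derivatives are directional derivatives along the canonical basis;
   the norm of the gradient is the Euclidean one, whereas `|_| on 'rV[R]_n is
   the sup norm. *)
Section differential_operators.
Context {R : realType} (n : nat).
Implicit Type f : 'rV[R]_n -> R.

Definition partial (i : 'I_n) f : 'rV[R]_n -> R := 'D_(delta_mx ord0 i) f.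

Definition laplacian f (x : 'rV[R]_n) : R :=
  \sum_(i < n) partial i (partial i f) x.

Definition sqnorm_grad f (x : 'rV[R]_n) : R := \sum_(i < n) partial i f x ^+ 2.

End differential_operators.

Section potential.
Context {R : realType}.

Definition u_ (alpha x : R) : R :=
  if 1 < `|x| then `|x| `^ alpha
  else alpha * (alpha - 2) / 8 * x ^+ 4 + alpha * (4 - alpha) / 4 * x ^+ 2
       + (1 - 3 / 4 * alpha + 1 / 8 * alpha ^+ 2).

Definition U_ n (alpha : R) (x : 'rV[R]_n) : R := \sum_(i < n) u_ alpha (x ord0 i).

Lemma measurable_u_ alpha : measurable_fun setT (u_ alpha).
Proof.
apply: measurable_fun_ifT.
- exact: measurable_fun_ltr.
- apply: (measurableT_comp (measurable_powR alpha)); exact: normr_measurable.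
- apply: measurable_funD => //; apply: measurable_funD;
    apply: measurable_funM => //; exact: exprn_measurable.
Qed.

Lemma measurable_U_ n alpha : measurable_fun setT (@U_ n alpha).
Proof.
apply: measurable_sum => i.
exact: (measurableT_comp (measurable_u_ alpha) (measurable_coord i)).
Qed.

End potential.

Section boltzmann.
Context {R : realType} (n : nat) (alpha : R).

Let density (x : 'rV[R]_n) : \bar R := (expR (- 2 * U_ alpha x))%:E.

Definition boltzmann_Z : \bar R := (\int[lebesgue_rV n]_x density x)%E.

Definition boltzmann (A : set 'rV[R]_n) : \bar R :=
  ((fine boltzmann_Z)^-1%:E * \int[lebesgue_rV n]_(x in A) density x)%E.

Let density_ge0 x : (0 <= density x)%E.
Proof. by rewrite lee_fin expR_ge0. Qed.

Let Z_ge0 : (0 <= (fine boltzmann_Z)^-1%:E)%E.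
Proof. by rewrite lee_fin invr_ge0 fine_ge0// integral_ge0. Qed.

Let boltzmann0 : boltzmann set0 = 0%E.
Proof. by rewrite /boltzmann integral_set0 mule0. Qed.

Let boltzmann_ge0 A : (0 <= boltzmann A)%E.
Proof. by rewrite mule_ge0// integral_ge0. Qed.

Let boltzmann_sigma_additive : semi_sigma_additive boltzmann.
Proof.
move=> F mF tF mUF; rewrite /boltzmann ge0_integral_bigcup//; last first.
  apply: measurable_funTS; apply/measurable_EFinP.
  apply: measurableT_comp => //; apply: measurable_funM => //.
  exact: measurable_U_.
rewrite -nneseriesZl//; last by move=> *; exact: integral_ge0.
by apply: is_cvg_nneseries => *; rewrite mule_ge0// integral_ge0.
Qed.

HB.instance Definition _ := isMeasure.Build _ _ _ boltzmann
  boltzmann0 boltzmann_ge0 boltzmann_sigma_additive.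

End boltzmann.

Section brownian_motion.
Context d {Omega : measurableType d} {R : realType}.

(* Taking some of the A i to be setT gives the product rule for every
   subfamily. *)
Definition mutually_independent (P : probability Omega R) (I : finType)
    d' (T : measurableType d') (Y : I -> Omega -> T) : Prop :=
  forall A : I -> set T, (forall i, measurable (A i)) ->
    P (\bigcap_i (Y i @^-1` A i)) = (\prod_(i : I) P (Y i @^-1` A i))%E.

(* X is an n-dimensional Brownian motion started at x under P: its increments
   over the successive intervals of any increasing sequence of times are
   independent, and X t - X s has law N(0, (t - s) Id). The second argument of
   normal_prob is the standard deviation. *)
Definition brownian_motion n (P : probability Omega R)
    (X : R -> Omega -> 'rV[R]_n) (x : 'rV[R]_n) : Prop :=
  [/\ forall t, 0 <= t -> measurable_fun setT (X t),
      {ae P, forall w, X 0 w = x},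
      forall w, {within `[0, +oo[, continuous (X ^~ w)},
      forall (k : nat) (s : nat -> R), 0 <= s 0%N ->
        {homo s : i j / (i < j)%N >-> i < j} ->
        mutually_independent P
          (fun (j : 'I_k) w => X (s j.+1) w - X (s j) w)
    & forall s t, 0 <= s < t ->
        mutually_independent P
          (fun (i : 'I_n) w => (X t w - X s w) ord0 i) /\
        forall i A, measurable A ->
          P [set w | A ((X t w - X s w) ord0 i)] =
          normal_prob 0 (Num.sqrt (t - s)) A].

End brownian_motion.

(* The Feynman-Kac representation of the semigroup generated by
   (1/2) Laplacian - grad U . grad, for non-negative h; it takes values in
   [0, +oo]. *)
Section semigroup.
Context d {Omega : measurableType d} {R : realType} (n : nat).
Variables (P : 'rV[R]_n -> probability Omega R) (X : R -> Omega -> 'rV[R]_n).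

Definition feynman_kac_weight (U : 'rV[R]_n -> R) (t : R) (w : Omega) : R :=
  expR (2^-1 * \int[lebesgue_measure]_(s in `[0, t])
                 (laplacian U (X s w) - sqnorm_grad U (X s w))).

Definition semigroup (alpha t : R) (h : 'rV[R]_n -> R) (x : 'rV[R]_n) : \bar R :=
  ((expR (U_ alpha x))%:E *
   'E_(P x)[fun w => (h (X t w) * expR (- U_ alpha (X t w)) *
                      feynman_kac_weight (U_ alpha) t w)%R])%E.

End semigroup.

Section orlicz.
Context {R : realType}.

Definition young_function (tau : R -> R) : Prop :=
  [/\ continuous tau, forall y, tau (- y) = tau y,
      convex_function [set: R] tau & tau 0 = 0].

(* A Young function is extended by +oo at both infinities, so that membership
   in L_ forces f to be finite almost everywhere. *)
Definition young_ext (tau : R -> R) (y : \bar R) : \bar R :=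
  if y is r%:E then (tau r)%:E else +oo%E.

Definition L_ d (T : measurableType d) (mu : {measure set T -> \bar R})
    (tau : R -> R) : set (T -> \bar R) :=
  [set f | measurable_fun setT f /\
           (\int[mu]_x young_ext tau (f x) < +oo)%E].

End orlicz.

(* Main.v *)
Require Import Defs.
From HB Require Import structures.
From mathcomp Require Import all_boot all_order all_algebra.
From mathcomp Require Import all_classical all_reals all_analysis.
From mathcomp Require Import measurable_realfun ring lra.

Set Implicit Arguments.
Unset Strict Implicit.
Unset Printing Implicit Defensive.

Import Order.TTheory GRing.Theory Num.Theory.
Import numFieldNormedType.Exports.

Local Open Scope classical_set_scope.
Local Open Scope ring_scope.

(** Write $\beta=2(\alpha-1)\in(0,2)$ and $M_t$ for the Feynman-Kac weight. The
    function $h=e^{U_\alpha}$ cancels the factor $e^{-U_\alpha(X_t)}$, so that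
    $\mathbf P_t^\alpha(e^{U_\alpha})(x)=e^{U_\alpha(x)}\,\mathbb E_x[M_t]$, and
    $\tau(y)=y^2\psi(y)$ turns the integral to be bounded into
    $$Z_\alpha^{-1}\int\mathbb E_x[M_t]^2\,
      \psi\big(e^{U_\alpha(x)}\mathbb E_x[M_t]\big)\,dx.$$
    It is enough to know how fast $\mathbb E_x[M_t]$ decays and how fast $\psi$
    can grow.

    Decay ([weight_expectation_le]): for every $a<\alpha^2$,
    $\mathbb E_x[M_t]\le K\exp(-\frac{at}2\sum_i|x_i|^\beta)$. Indeed
    $\Delta U_\alpha-|\nabla U_\alpha|^2$ is a sum over the coordinates of a
    function at most $6-\alpha^2|y|^\beta$ ([v_le]), and up to the factor
    $a/\alpha^2$ and an additive error $O(|w|^\beta)$ the value at $x+w$ may be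
    replaced by the value at $x$ ([v_perturb_le]). What remains is the
    exponential of a mean, over time and coordinates, of
    $O(|X_s^i-x_i|^\beta)$. By Jensen's inequality it is at most the mean of the
    exponentials, whose expectations are bounded because $\beta<2$ and
    $X_s^i-x_i$ is Gaussian with variance at most $t$. This step rests on the
    one-dimensional marginals of the process.

    Growth ([psi_expR_le]): $\psi$ being monotone, the integrability hypothesis
    gives $\psi(e^y)\le C\exp(bt\,y^{\beta/\alpha})$ for large $y$, with some
    $b<\alpha^2$. Since $U_\alpha(x)\le\sum_i|x_i|^\alpha+2n$ and
    $\beta/\alpha\le1$, subadditivity of $y\mapsto y^{\beta/\alpha}$ yields
    $\psi(e^{U_\alpha}\mathbb E_x[M_t])\le C'\exp(bt\sum_i|x_i|^\beta)$. Taking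
    $b<a<\alpha^2$, the integrand is at most a constant times
    $\prod_i e^{-(a-b)t|x_i|^\beta}$ ([young_density_le]), which is integrable
    over $\mathbb R^n$ by Tonelli's theorem.

    Measurability of $x\mapsto\mathbb E_x[M_t]$
    ([measurable_weight_expectation]) is not automatic, the probabilities
    $\mathbb P_x$ being an arbitrary family. The weight is the limit of its
    Riemann sums $F_N$, and $F_N$ is a function of the starting point and of
    finitely many increments, whose joint law is the same for all starting
    points. Hence $\mathbb E_x[F_N]$ is an expectation under $\mathbb P_0$ that
    depends measurably on the parameter $x$. The same Riemann sums make the use
    of Jensen's inequality above a finite statement. *)

(** * Riemann sums *)

Lemma continuous_subinterval_integrable {R : realType} (g : R -> R) (a b : R)
    (A : set (measurableTypeR R)) :
  continuous g -> measurable A -> A `<=` `[a, b] ->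
  lebesgue_measure.-integrable A (EFin \o g).
Proof.
move=> cg mA Aab.
have H : lebesgue_measure.-integrable `[a, b] (EFin \o g).
  apply: continuous_compact_integrable; first exact: segment_compact.
  by apply: continuous_subspaceT.
exact: (integrableS _ mA Aab H).
Qed.

(** Heine's theorem on a segment, in the form that a Riemann sum needs: one mesh
    controls the oscillation around every point of the segment. *)
Lemma near_uniform_modulus {R : realType} (g : R -> R) (a b t e : R) :
  continuous g -> 0 < t -> 0 < e ->
  \forall N \near \oo, forall x y, x \in `[a, b] -> `|y - x| <= t / N.+1%:R ->
    `|g y - g x| <= e.
Proof.
move=> cg t0 e0.
have /compact_near_coveringP/(_ nat \oo (fun N x => forall y,
   `|y - x| <= t / N.+1%:R -> `|g y - g x| <= e) _) := @segment_compact R a b.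
move=> /(_ _)[x _|N _ HN]; last first.
  by exists N => // k Nk x y xab; apply: (HN k Nk x).
have e2 : 0 < e / 2 by rewrite divr_gt0.
have /cvgrPdist_le/(_ _ e2) := cg x.
move=> [r /= r0 Hr].
have r2 : 0 < r / 2 by rewrite divr_gt0.
have h0 : t / N.+1%:R @[N --> \oo] --> 0.
  rewrite -(mulr0 t); apply: cvgMr; exact: cvg_harmonic.
have /cvgrPdist_lt/(_ _ r2) [M _ HM] := h0.
exists (ball x (r / 2), [set N | (M <= N)%N]) => /=.
  split; first exact: nbhsx_ballx.
  by exists M.
move=> [z N] /= [xz MN] y yz.
have := HM _ MN; rewrite sub0r normrN ger0_norm; last by rewrite divr_ge0// ltW.
move=> tN; rewrite /ball /= in xz.
have gy : `|g x - g y| <= e / 2.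
  apply: Hr => /=; rewrite (_ : x - y = (x - z) - (y - z)); last by ring.
  rewrite (le_lt_trans (ler_normB _ _))// (splitr r) ltr_leD//.
  exact: (le_trans yz (ltW tN)).
have gz : `|g x - g z| <= e / 2.
  by apply: Hr => /=; rewrite (lt_trans xz)// ltr_pdivrMr// ltr_pMr// ltr1n.
rewrite (_ : g y - g z = (g x - g z) - (g x - g y)); last by ring.
by rewrite (le_trans (ler_normB _ _))// (splitr e) lerD.
Qed.

Lemma riemann_sum_cvg {R : realType} (g : R -> R) (t : R) :
  continuous g -> 0 < t ->
  t / N.+1%:R * \sum_(k < N.+1) g (k%:R * (t / N.+1%:R)) @[N --> \oo] -->
  \int[lebesgue_measure]_(s in `[0, t]) g s.
Proof.
move=> cg t0; apply/cvgrPdist_le => e e0.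
have et0 : 0 < e / t by rewrite divr_gt0.
near=> N.
have HN : forall x y, x \in `[0, t] -> `|y - x| <= t / N.+1%:R ->
    `|g y - g x| <= e / t.
  by near: N; exact: near_uniform_modulus.
set d := t / N.+1%:R in HN *.
have d0 : 0 < d by rewrite divr_gt0.
have ndt : N.+1%:R * d = t by rewrite /d mulrC divfK.
suff H (j : nat) : (j <= N.+1)%N ->
    `|\int[lebesgue_measure]_(s in `[0, j%:R * d]) g s -
      d * \sum_(k < j) g (k%:R * d)| <= j%:R * d * (e / t).
  have := H _ (leqnn _); rewrite ndt => /le_trans; apply.
  by rewrite mulrC divfK// gt_eqF.
elim: j => [|j IH] jN.
  by rewrite !mul0r set_itv1 Rintegral_set1 big_ord0 mulr0 subrr normr0.
have jd0 : 0 <= j%:R * d by rewrite mulr_ge0// ltW.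
have jdt : j.+1%:R * d <= t by rewrite -ndt ler_pM2r// ler_nat.
have jS : j.+1%:R * d = j%:R * d + d by rewrite -natr1 mulrDl mul1r.
have ijd (A : set (measurableTypeR R)) : measurable A -> A `<=` `[0, j.+1%:R * d] ->
    lebesgue_measure.-integrable A (EFin \o g).
  by move=> mA; exact: continuous_subinterval_integrable.
have split_int : \int[lebesgue_measure]_(s in `[0, j.+1%:R * d]) g s =
    \int[lebesgue_measure]_(s in `[0, j%:R * d]) g s +
    \int[lebesgue_measure]_(s in `]j%:R * d, j.+1%:R * d]) g s.
  rewrite -[X in _ = _ + X](@Rintegral_itvB _ _ (BLeft 0)).
  - by rewrite addrC subrK.
  - exact: ijd.
  - by rewrite bnd_simp.
  - by rewrite bnd_simp jS lerDl ltW.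
set A := `]j%:R * d, j.+1%:R * d]%classic in split_int.
have mA : @measurable _ (measurableTypeR R) A by exact: measurable_itv.
have A0 : A `<=` `[0, j.+1%:R * d].
  move=> x; rewrite /A /= !in_itv/= => /andP[/ltW jx xj].
  by rewrite xj (le_trans jd0).
have muA : fine (lebesgue_measure A) = d.
  rewrite /A jS (lebesgue_measure_itv `]j%:R * d, (j%:R * d + d)%R]) /= lte_fin.
  by rewrite ltrDl d0/= addrAC subrr add0r.
have cint (c : R) : lebesgue_measure.-integrable A (EFin \o cst c).
  by apply: (@continuous_subinterval_integrable _ _ 0 (j.+1%:R * d)) => // x;
    exact: cvg_cst.
have step : `|\int[lebesgue_measure]_(s in A) g s - d * g (j%:R * d)| <=
    d * (e / t).
  rewrite -[X in X * g _]muA mulrC -Rintegral_cst// -RintegralB//; last 2 first.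
  - exact: ijd.
  - exact: cint.
  have iB : lebesgue_measure.-integrable A (EFin \o (fun x => g x - g (j%:R * d))).
    apply: (@continuous_subinterval_integrable _ _ 0 (j.+1%:R * d)) => // x.
    by apply: cvgB; [exact: cg|exact: cvg_cst].
  have /le_trans := le_normr_Rintegral mA iB; apply.
  rewrite -[X in _ <= X * _]muA [leRHS]mulrC -Rintegral_cst//.
  apply: le_Rintegral => //.
  - exact: (@integrable_norm _ _ _ _ _ _ iB).
  - exact: cint.
  - move=> x; rewrite /A /= in_itv/= => /andP[jx xj].
    apply: HN; first by rewrite in_itv/= jd0 (le_trans _ jdt)// jS lerDl ltW.
    by rewrite ger0_norm ?subr_ge0 ?(ltW jx)// lerBlDl -jS.
rewrite big_ord_recr/= mulrDr split_int jS mulrDl opprD addrACA.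
by rewrite (le_trans (ler_normD _ _))// lerD// IH// ltnW.
Unshelve. all: by end_near.
Qed.

(** * Derivatives of the one-dimensional potential *)

Lemma is_derive1_near_eq {R : realType} (f g : R -> R) (x df : R) :
  (\near x, f x = g x) -> is_derive x 1 f df -> is_derive x 1 g df.
Proof. exact: near_eq_is_derive. Qed.

(** In Caratheodory's form of differentiability, it is the slopes of the two
    pieces that are glued. *)
Lemma is_derive1_glue {R : realType} (p q : R -> R) (a l : R) :
  p a = q a -> is_derive a 1 p l -> is_derive a 1 q l ->
  is_derive a 1 (fun x => if x <= a then p x else q x) l.
Proof.
move=> pqa /is_derive1_caratheodory[gp [pE cp gpa]].
move=> /is_derive1_caratheodory[gq [qE cq gqa]].
apply/is_derive1_caratheodory.
exists (fun x => if x <= a then gp x else gq x); split.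
- move=> z; rewrite lexx; case: ifP => _; first exact: pE.
  by rewrite pqa; exact: qE.
- move=> /=; rewrite /continuous_at lexx.
  apply/cvgrPdist_le => e e0.
  move/cvgrPdist_le: cp => /(_ _ e0) cp; move/cvgrPdist_le: cq => /(_ _ e0) cq.
  near=> z; case: ifP => _; first by near: z.
  by rewrite gpa -gqa; near: z.
- by rewrite lexx.
Unshelve. all: by end_near. Qed.

(** A function glued from two pieces at the points $\pm1$ is handled on the
    right half line first, parity doing the rest. *)
Lemma is_derive1_glue_norm {R : realType} (p q p' q' : R -> R) (x : R) :
  (forall z : R, is_derive z 1 p (p' z)) ->
  (forall z : R, 0 < z -> is_derive z 1 q (q' z)) ->
  p 1 = q 1 -> p' 1 = q' 1 -> 0 <= x ->
  is_derive x 1 (fun z => if 1 < `|z| then q z else p z)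
    (if 1 < `|x| then q' x else p' x).
Proof.
move=> dp dq pq1 dpq1 x0.
have xN1 : -1 < x by rewrite (lt_le_trans _ x0)// ltrN10.
rewrite (ger0_norm x0).
apply: (@is_derive1_near_eq R (fun z => if z <= 1 then p z else q z)).
  near=> z.
  have z1 : -1 < z by near: z; exact: lt_nbhsr.
  have [z0|z0] := leP 0 z; first by rewrite ger0_norm// ltNge; case: leP.
  by rewrite ltr0_norm// (ltW (lt_trans z0 ltr01)) ltNge lerNl (ltW z1).
have [x1|x1|->] := ltgtP x 1.
- apply: (is_derive1_near_eq _ (dp x)).
  by near=> z; rewrite ifT// ltW//; near: z; exact: lt_nbhsl.
- apply: (is_derive1_near_eq _ (dq _ (lt_trans ltr01 x1))).
  by near=> z; rewrite ifF// leNgt; apply/negbF; near: z; exact: lt_nbhsr.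
- apply: is_derive1_glue => //; rewrite dpq1; exact: dq.
Unshelve. all: by end_near. Qed.

Section potential1.
Context {R : realType} (alpha : R).

Definition du (x : R) : R :=
  if 1 < `|x| then alpha * Num.sg x * `|x| `^ (alpha - 1)
  else alpha * (alpha - 2) / 2 * x ^+ 3 + alpha * (4 - alpha) / 2 * x.

Definition d2u (x : R) : R :=
  if 1 < `|x| then alpha * (alpha - 1) * `|x| `^ (alpha - 2)
  else 3 / 2 * alpha * (alpha - 2) * x ^+ 2 + alpha * (4 - alpha) / 2.

Lemma is_derive_norm_powR (a x : R) : 0 < x ->
  is_derive x 1 (fun z => `|z| `^ a) (a * x `^ (a - 1)).
Proof.
move=> x0; apply: (@is_derive1_near_eq R (fun z => z `^ a)).
  by near=> z; rewrite gtr0_norm//; near: z; exact: lt_nbhsr.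
exact: is_derive1_powR.
Unshelve. all: by end_near. Qed.

Lemma u_N x : u_ alpha (- x) = u_ alpha x.
Proof. by rewrite /u_ normrN; case: ifP => // _; ring. Qed.

Lemma duN x : du (- x) = - du x.
Proof. by rewrite /du normrN sgrN; case: ifP => // _; ring. Qed.

Lemma d2uN x : d2u (- x) = d2u x.
Proof. by rewrite /d2u normrN; case: ifP => // _; ring. Qed.

Lemma is_derive_u (x : R) : is_derive x 1 (u_ alpha) (du x).
Proof.
suff pos (z : R) : 0 <= z -> is_derive z 1 (u_ alpha) (du z).
  have [x0|x0] := leP 0 x; first exact: pos.
  rewrite (_ : u_ alpha = u_ alpha \o -%R); last first.
    by apply/funext => z /=; rewrite u_N.
  rewrite (_ : du x = du (- x) * -1); last by rewrite duN mulrN1 opprK.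
  have Nx0 : 0 <= - x by rewrite oppr_ge0 ltW.
  exact: (@is_derive1_comp _ _ _ _ _ _ (pos _ Nx0) (is_deriveNid x 1)).
move=> z0.
rewrite (_ : du z = if 1 < `|z| then alpha * z `^ (alpha - 1)
   else alpha * (alpha - 2) / 2 * z ^+ 3 + alpha * (4 - alpha) / 2 * z); last first.
  rewrite /du (ger0_norm z0); case: ifP => // z1.
  by rewrite gtr0_sg ?mulr1// (lt_trans _ z1).
apply: (is_derive1_glue_norm (q := fun x => `|x| `^ alpha)
  (q' := fun x => alpha * x `^ (alpha - 1)) (p := fun x =>
    alpha * (alpha - 2) / 8 * x ^+ 4 + alpha * (4 - alpha) / 4 * x ^+ 2
       + (1 - 3 / 4 * alpha + 1 / 8 * alpha ^+ 2))
  (p' := fun x => alpha * (alpha - 2) / 2 * x ^+ 3 +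
                  alpha * (4 - alpha) / 2 * x)) => //.
- move=> y; apply: is_derive_eq.
  by rewrite /GRing.scale/=; field.
- by move=> y y0; exact: is_derive_norm_powR.
- by rewrite normr1 !expr1n powR1; field.
- by rewrite powR1 !expr1n; field.
Qed.

Lemma is_derive_du (x : R) : is_derive x 1 du (d2u x).
Proof.
suff pos (z : R) : 0 <= z -> is_derive z 1 du (d2u z).
  have [x0|x0] := leP 0 x; first exact: pos.
  rewrite (_ : du = - (du \o -%R)); last first.
    by apply/funext => z /=; rewrite fctE /= duN opprK.
  rewrite (_ : d2u x = - (d2u (- x) * -1)); last by rewrite d2uN mulrN1 opprK.
  have Nx0 : 0 <= - x by rewrite oppr_ge0 ltW.
  apply: is_deriveN.
  exact: (@is_derive1_comp _ _ _ _ _ _ (pos _ Nx0) (is_deriveNid x 1)).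
move=> z0.
rewrite (_ : d2u z = if 1 < `|z| then alpha * ((alpha - 1) * z `^ (alpha - 1 - 1))
   else 3 / 2 * alpha * (alpha - 2) * z ^+ 2 + alpha * (4 - alpha) / 2); last first.
  rewrite /d2u (ger0_norm z0); case: ifP => // z1; rewrite mulrA.
  by congr (_ * _ `^ _); ring.
apply: (is_derive1_glue_norm
  (q := fun x => alpha * Num.sg x * `|x| `^ (alpha - 1))
  (q' := fun x => alpha * ((alpha - 1) * x `^ (alpha - 1 - 1)))
  (p := fun x => alpha * (alpha - 2) / 2 * x ^+ 3 +
                 alpha * (4 - alpha) / 2 * x)
  (p' := fun x => 3 / 2 * alpha * (alpha - 2) * x ^+ 2 +
                  alpha * (4 - alpha) / 2)) => //.
- move=> y; apply: is_derive_eq.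
  by rewrite /GRing.scale/=; field.
- move=> y y0; apply: (@is_derive1_near_eq R (fun z => alpha * `|z| `^ (alpha - 1))).
    near=> w; have w0 : 0 < w by near: w; exact: lt_nbhsr.
    by rewrite gtr0_sg// mulr1.
  apply: is_deriveZ; exact: is_derive_norm_powR.
- by rewrite normr1 !expr1n powR1 sgr1; field.
- by rewrite powR1 !expr1n; field.
Unshelve. all: by end_near. Qed.

End potential1.

(** * The Feynman-Kac potential *)

Section partial_derivatives.
Context {R : realType} (n : nat).

(** Along a vector of the canonical basis, a function of one coordinate has the
    same difference quotients as the function of one variable, or constant
    ones. *)
Lemma is_derive_coord (f f' : R -> R) (i j : 'I_n) (x : 'rV[R]_n) :
  (forall y : R, is_derive y 1 f (f' y)) ->
  is_derive x (delta_mx ord0 i) (fun z : 'rV[R]_n => f (z ord0 j))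
    (if i == j then f' (x ord0 j) else 0).
Proof.
move=> df; have [fx fxE] := df (x ord0 j).
have E : (fun h : R => h^-1 *: (((fun z : 'rV[R]_n => f (z ord0 j)) \o shift x)
      (h *: delta_mx ord0 i) - f (x ord0 j))) =
    (if i == j then fun h => h^-1 *: ((f \o shift (x ord0 j)) (h *: 1) -
       f (x ord0 j)) else cst 0).
  apply/funext => h /=; rewrite !mxE eqxx/= eq_sym; case: eqP => //= _.
  by rewrite mulr0 add0r subrr scaler0.
apply: DeriveDef.
  rewrite /derivable E; case: eqP => // _; exact: is_cvg_cst.
rewrite /derive E; case: eqP => // _; apply: cvg_lim => //; exact: cvg_cst.
Qed.

Lemma partial_sum_coord (f f' : R -> R) (i : 'I_n) :
  (forall y : R, is_derive y 1 f (f' y)) ->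
  partial i (fun x : 'rV[R]_n => \sum_(j < n) f (x ord0 j)) =
  fun x => f' (x ord0 i).
Proof.
move=> df; apply/funext => x; rewrite /partial.
have := @is_derive_sum _ _ _ n (fun j (z : 'rV[R]_n) => f (z ord0 j)) x
  (delta_mx ord0 i) _ (fun j => is_derive_coord i j x df).
rewrite (_ : \sum_(_ < _) _ = (fun z : 'rV[R]_n => \sum_(j < n) f (z ord0 j))).
  move=> [_ ->]; rewrite (bigD1 i)//= eqxx big1 ?addr0// => j ji.
  by rewrite eq_sym (negbTE ji).
by apply/funext => z; rewrite fct_sumE.
Qed.

Lemma partial_coord (f f' : R -> R) (i : 'I_n) :
  (forall y : R, is_derive y 1 f (f' y)) ->
  partial i (fun x : 'rV[R]_n => f (x ord0 i)) = fun x => f' (x ord0 i).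
Proof.
move=> df; apply/funext => x; rewrite /partial.
by have [_ ->] := is_derive_coord i i x df; rewrite eqxx.
Qed.

End partial_derivatives.

(** The contribution of one coordinate to $\Delta U_\alpha-|\nabla U_\alpha|^2$. *)
Definition v_ {R : realType} (alpha x : R) : R := d2u alpha x - du alpha x ^+ 2.

(** The potential separates: both operators act coordinate by coordinate. *)
Lemma laplacian_sub_sqnorm_grad_U {R : realType} n (alpha : R) (x : 'rV[R]_n) :
  laplacian (U_ alpha) x - sqnorm_grad (U_ alpha) x =
  \sum_(i < n) v_ alpha (x ord0 i).
Proof.
rewrite /laplacian /sqnorm_grad -sumrB; apply: eq_bigr => i _.
by rewrite (partial_sum_coord i (is_derive_u alpha))
  (partial_coord i (is_derive_du alpha)).
Qed.

Section potential_bounds.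
Context {R : realType} (alpha : R).

Lemma continuous_du : continuous (du alpha).
Proof.
move=> x; apply: differentiable_continuous; apply/derivable1_diffP.
by have [] := is_derive_du alpha x.
Qed.

Lemma continuous_d2u : continuous (d2u alpha).
Proof.
(* the two pieces agree at distance 1 from the origin *)
rewrite (_ : d2u alpha = fun x =>
  alpha * (alpha - 1) * (Num.max `|x| 1) `^ (alpha - 2) +
  3 / 2 * alpha * (alpha - 2) * (Num.min `|x| 1 ^+ 2 - 1)); last first.
  apply/funext => x; rewrite /d2u; case: ltP => x1.
    by ring.
  by rewrite powR1 real_normK ?num_real//; field.
move=> x; apply: cvgD.
  apply: cvgM; first exact: cvg_cst.
  apply: (@continuous_comp _ _ _ (fun x : R => Num.max `|x| 1)
    (fun y => y `^ (alpha - 2))).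
    by apply: continuous_max; [exact: norm_continuous|exact: cvg_cst].
  apply: differentiable_continuous; apply/derivable1_diffP.
  have m0 : 0 < Num.max `|x| 1 by rewrite lt_max ltr01 orbT.
  by have [] := is_derive1_powR (alpha - 2) m0.
apply: cvgM; first exact: cvg_cst.
apply: cvgB; last exact: cvg_cst.
apply: (@continuous_comp _ _ _ (fun x : R => Num.min `|x| 1) (fun y => y ^+ 2)).
  by apply: continuous_min; [exact: norm_continuous|exact: cvg_cst].
exact: exprn_continuous.
Qed.

Lemma continuous_v : continuous (v_ alpha).
Proof.
move=> x; apply: cvgB; first exact: continuous_d2u.
apply: (@continuous_comp _ _ _ (du alpha) (fun y => y ^+ 2)).
  exact: continuous_du.
exact: exprn_continuous.
Qed.

Lemma v_le x : 1 < alpha -> alpha < 2 ->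
  v_ alpha x <= 6 - alpha ^+ 2 * `|x| `^ (2 * (alpha - 1)).
Proof.
move=> alpha_gt1 alpha_lt2; have b0 : 0 <= 2 * (alpha - 1)  by lra.
rewrite /v_ /d2u /du; case: ltP => x1.
  have x0 : 0 < `|x| by rewrite (lt_trans _ x1).
  rewrite lerB//.
    have -> : 6 = 3 * 2 :> R by ring.
    have aa0 : 0 <= (2 - alpha) * (alpha + 1) by apply: mulr_ge0; lra.
    have aa1 : 0 <= alpha * (alpha - 1) by apply: mulr_ge0; lra.
    apply: ler_pM; rewrite ?powR_ge0//; [nra|].
    rewrite (@le_trans _ _ 1) ?ler1n// -[leRHS](powRr0 `|x|).
    by apply: ler_powR; [exact: ltW|lra].
  rewrite !exprMn sqr_sg (_ : x != 0) -?normr_gt0// mulr1.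
  by rewrite -(@powR_mulrn _ (`|x| `^ _)) ?powR_ge0// -powRrM [(_ - _) * _]mulrC.
have P1 : `|x| `^ (2 * (alpha - 1)) <= 1.
  rewrite [leRHS](_ : 1 = 1 `^ (2 * (alpha - 1))) ; last by rewrite powR1.
  by apply: (@ge0_ler_powR _ _ b0); rewrite ?nnegrE.
have P0 := powR_ge0 `|x| (2 * (alpha - 1)).
have x2 := sqr_ge0 x.
set p := (_ + _) ^+ 2; have p0 : 0 <= p by exact: sqr_ge0.
have h1 : 3 / 2 * alpha * (alpha - 2) * x ^+ 2 <= 0.
  by rewrite mulr_le0_ge0//; nra.
have h2 : alpha ^+ 2 * `|x| `^ (2 * (alpha - 1)) <= 4 by nra.
have h3 : alpha * (4 - alpha) / 2 <= 2 by nra.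
lra.
Qed.

Lemma u_le x : 1 < alpha -> alpha < 2 ->
  u_ alpha x <= `|x| `^ alpha + 2.
Proof.
move=> alpha_gt1 alpha_lt2; rewrite /u_; case: ltP => x1; first by rewrite lerDl.
have x2 := sqr_ge0 x; have x4 := sqr_ge0 (x ^+ 2).
rewrite -exprM in x4.
have x21 : x ^+ 2 <= 1 by rewrite -real_normK ?num_real// expr_le1.
have h1 : alpha * (alpha - 2) / 8 * x ^+ 4 <= 0 by rewrite mulr_le0_ge0//; nra.
have h2 : alpha * (4 - alpha) / 4 * x ^+ 2 <= 1 by nra.
have P0 := powR_ge0 `|x| alpha.
have h3 : 1 - 3 / 4 * alpha + 1 / 8 * alpha ^+ 2 <= 1 by nra.
lra.
Qed.

End potential_bounds.

(** * Integration against a density, and power inequalities *)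

Section ge0_integral_density.
Local Open Scope ereal_scope.
Import HBNNSimple.

(** Both the Gaussian laws and the Boltzmann measure are defined through a
    density; monotone approximation by simple functions reduces the formula to
    that definition. *)
Lemma ge0_integral_density d (T : measurableType d) (R : realType)
    (mu nu : {measure set T -> \bar R}) (g : T -> R) (f : T -> \bar R) :
  measurable_fun setT g -> (forall x, (0 <= g x)%R) ->
  (forall A, measurable A -> nu A = \int[mu]_(x in A) (g x)%:E) ->
  measurable_fun setT f -> (forall x, 0 <= f x) ->
  \int[nu]_x f x = \int[mu]_x (f x * (g x)%:E).
Proof.
move=> mg g0 nuE mf f0.
have mT : measurable [set: T] by [].
pose h := nnsfun_approx mT mf.
have hf x : EFin \o h^~ x @ \oo --> f x by exact: cvg_nnsfun_approx.
have -> : \int[nu]_x f x = limn (fun n => \int[nu]_x (h n x)%:E).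
  rewrite -monotone_convergence//.
  - by apply: eq_integral => x _; apply/esym/cvg_lim => //; exact: hf.
  - by move=> n; exact/measurable_EFinP/measurable_funP.
  - by move=> n x _; rewrite lee_fin.
  - by move=> x _ m n mn; rewrite lee_fin; exact/lefP/nd_nnsfun_approx.
have -> : \int[mu]_x (f x * (g x)%:E) =
    limn (fun n => \int[mu]_x ((h n x)%:E * (g x)%:E)).
  rewrite -monotone_convergence//.
  - apply: eq_integral => x _; apply/esym/cvg_lim => //.
    by apply: cvgeZr => //; exact: hf.
  - move=> n; apply: emeasurable_funM; apply/measurable_EFinP => //.
  - by move=> n x _; rewrite mule_ge0 ?lee_fin.
  - move=> x _ m n mn; rewrite lee_wpmul2r ?lee_fin//.
    exact/lefP/nd_nnsfun_approx.
congr (limn _); apply/funext => n.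
under eq_integral do rewrite fimfunE -fsumEFin//.
rewrite ge0_integral_fsum//; last 2 first.
- by move=> r; exact/measurable_EFinP/measurable_funM.
- by move=> r x _; exact: nnfun_muleindic_ge0.
under [RHS]eq_integral => x _.
  rewrite fimfunE -fsumEFin// ge0_mule_fsuml; last first.
    by move=> r; exact: nnfun_muleindic_ge0.
  over.
rewrite ge0_integral_fsum//; last 2 first.
- move=> r; apply: emeasurable_funM; last exact/measurable_EFinP.
  by apply/measurable_EFinP; exact: measurable_funM.
- move=> r x _; apply: mule_ge0; last by rewrite lee_fin.
  exact: nnfun_muleindic_ge0.
apply: eq_fsbigr => r; rewrite inE => -[t _ <-].
under eq_integral do rewrite EFinM.
rewrite integralZl_indic_nnsfun// integral_indic// setIT nuE//.
under [RHS]eq_integral do rewrite EFinM -muleA.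
rewrite ge0_integralZl//; last 3 first.
- by apply: emeasurable_funM; apply/measurable_EFinP.
- by move=> x _; rewrite mule_ge0 ?lee_fin.
- by rewrite lee_fin.
congr (_ * _); rewrite integral_mkcond; apply: eq_integral => x _.
by rewrite epatch_indic muleC.
Qed.

End ge0_integral_density.

Section powR_estimates.
Context {R : realType}.
Implicit Types x w a b : R.

(** If $|w|\le\eta|x|$ then $|x+w|\ge(1-\eta)|x|$; otherwise $|x|$ is
    controlled by $|w|$. *)
Lemma powR_norm_perturb (be eta x w : R) : 0 <= be -> 0 < eta -> eta < 1 ->
  (1 - eta) `^ be * `|x| `^ be <=
  `|x + w| `^ be + eta^-1 `^ be * `|w| `^ be.
Proof.
move=> be0 eta0 eta1; have eta1' : 0 <= 1 - eta by rewrite subr_ge0 ltW.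
have mono (y z : R) : 0 <= y -> y <= z -> y `^ be <= z `^ be.
  move=> y0 yz; apply: (@ge0_ler_powR _ _ be0) => //; rewrite nnegrE//.
  exact: le_trans yz.
have etaV0 : 0 <= eta^-1 by rewrite invr_ge0 ltW.
rewrite -!powRM//; have [wx|xw] := leP `|w| (eta * `|x|).
  apply: ler_wpDr; first exact: powR_ge0.
  apply: mono; first by rewrite mulr_ge0.
  have : `|x| <= `|x + w| + `|w| by rewrite -{1}(addrK w x) ler_normB.
  lra.
apply: ler_wpDl; first exact: powR_ge0.
apply: mono; first by rewrite mulr_ge0.
rewrite [leRHS]mulrC ler_pdivlMr//.
have x0 := normr_ge0 x; nra.
Qed.

(** The threshold [M] is where $e|w|^{2-\beta}$ overtakes [B]. *)
Lemma powR_le_sqr (be B e : R) : 0 <= be -> be < 2 -> 0 <= B -> 0 < e ->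
  exists C : R, forall w, B * `|w| `^ be <= e * w ^+ 2 + C.
Proof.
move=> be0 be2 B0 e0; have be2' : 0 < 2 - be by rewrite subr_gt0.
pose M := (B / e) `^ (2 - be)^-1.
have M0 : 0 <= M by exact: powR_ge0.
exists (B * M `^ be) => w.
have [wM|Mw] := leP `|w| M.
  apply: ler_wpDl; first by rewrite mulr_ge0 ?sqr_ge0// ltW.
  by rewrite ler_wpM2l//; apply: (@ge0_ler_powR _ _ be0); rewrite ?nnegrE.
apply: ler_wpDr; first by rewrite mulr_ge0// powR_ge0.
have w0 : 0 < `|w| by rewrite (le_lt_trans _ Mw).
have -> : w ^+ 2 = `|w| `^ be * `|w| `^ (2 - be).
  rewrite -powRD; last by rewrite (gt_eqF w0) implybT.
  by rewrite addrC subrK powR_mulrn// real_normK ?num_real.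
have : B / e <= `|w| `^ (2 - be).
  have -> : B / e = M `^ (2 - be).
    rewrite -powRrM mulVf ?gt_eqF// powRr1// divr_ge0// ltW//.
  by apply: (@ge0_ler_powR _ _ (ltW be2')); rewrite ?nnegrE ?normr_ge0// ltW.
rewrite ler_pdivrMr// => Bw.
rewrite [leRHS](_ : _ = `|w| `^ (2 - be) * e * `|w| `^ be); last by ring.
by rewrite ler_wpM2r// powR_ge0.
Qed.

(** For a fraction $u\in[0,1]$ one has $u\le u^g$; apply it to the shares of $a$
    and $b$ in $a+b$. *)
Lemma powR_subadd (g a b : R) : 0 <= g <= 1 -> 0 <= a -> 0 <= b ->
  (a + b) `^ g <= a `^ g + b `^ g.
Proof.
move=> /andP[g0 g1] a0 b0; have [ab0|ab0] := eqVneq (a + b) 0.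
  have /eqP := ab0; rewrite paddr_eq0// => /andP[/eqP -> /eqP ->].
  by rewrite addr0 lerDl powR_ge0.
have s0 : 0 < a + b by rewrite lt_def ab0 addr_ge0.
have frac (c : R) : 0 <= c -> c <= a + b -> c / (a + b) * (a + b) `^ g <= c `^ g.
  move=> c0 cs; have [->|cn0] := eqVneq c 0; first by rewrite !mul0r powR_ge0.
  rewrite -[in leRHS](divfK ab0 c) [leRHS]powRM ?divr_ge0// ?(ltW s0)//.
  rewrite ler_wpM2r ?powR_ge0//; apply: ger1_powR => //.
  have cp : 0 < c by rewrite lt_def cn0.
  by rewrite divr_gt0//= ler_pdivrMr// mul1r.
rewrite -[leLHS]mul1r -(divff ab0) mulrDl [leLHS]mulrDl.
by rewrite lerD// frac// ?lerDl ?lerDr.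
Qed.

Lemma powR_subadd_sum (g : R) (I : Type) (r : seq I) (F : I -> R) :
  0 < g <= 1 -> (forall i, 0 <= F i) ->
  (\sum_(i <- r) F i) `^ g <= \sum_(i <- r) F i `^ g.
Proof.
move=> /andP[g0 g1] F0; elim: r => [|i r IH].
  by rewrite !big_nil powR0// gt_eqF.
rewrite !big_cons (le_trans (powR_subadd _ _ _)) ?(ltW g0)//.
  exact: sumr_ge0.
by rewrite lerD2l.
Qed.

End powR_estimates.

(** Jensen's inequality, from the tangent line of [expR] at the mean. *)
Lemma expR_mean_le {R : realType} (I : finType) (a : I -> R) : (0 < #|I|)%N ->
  expR (#|I|%:R^-1 * \sum_i a i) <= #|I|%:R^-1 * \sum_i expR (a i).
Proof.
move=> I0; have I0' : 0 < #|I|%:R :> R by rewrite ltr0n.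
set m := _ * \sum_i a i.
have tangent i : expR m * (1 + (a i - m)) <= expR (a i).
  rewrite -[in leRHS](subrK m (a i)) expRD mulrC ler_wpM2r ?expR_ge0//.
  exact: expR_ge1Dx.
rewrite mulrC ler_pdivlMr//.
apply: le_trans (ler_sum _ (fun i _ => tangent i)).
rewrite -mulr_sumr big_split/= sumrB !sumr_const.
have -> : \sum_i a i = m *+ #|I| by rewrite /m -mulr_natl mulVKf// gt_eqF.
by rewrite subrr addr0.
Qed.

(** * The law of the Brownian increments *)

(** A finite Borel measure on $\mathbb R^m$ is determined by its values on
    boxes, which form a pi-system generating the sigma-algebra. *)
Lemma rV_measure_unique {R : realType} m
    (mu nu : {measure set 'rV[R]_m -> \bar R}) :
  (mu setT < +oo)%E ->
  (forall A : 'I_m -> set R, (forall i, measurable (A i)) ->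
    mu [set x : 'rV[R]_m | forall i, A i (x ord0 i)] =
    nu [set x : 'rV[R]_m | forall i, A i (x ord0 i)]) ->
  forall B, measurable B -> mu B = nu B.
Proof.
move=> mufin box.
pose G : set (set 'rV[R]_m) := [set B | exists A : 'I_m -> set R,
  (forall i, measurable (A i)) /\ B = [set x : 'rV[R]_m | forall i, A i (x ord0 i)]].
have GT : G setT.
  by exists (fun=> setT); split=> //; apply/seteqP; split.
apply: (measure_unique G (fun=> setT)) => //.
- apply/seteqP; split.
  + apply: smallest_sub; first exact: smallest_sigma_algebra.
    rewrite -bigcup_seq; apply: bigcup_sub => i _ _ [B mB <-] /=.
    apply: sub_sigma_algebra.
    exists (fun j => if j == i then B else setT); split.
      by move=> j; case: ifP.
    apply/seteqP; split=> x /=.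
      by move=> [_ Bx] j; case: eqP => // ->.
    by move=> /(_ i); rewrite eqxx.
  + apply: smallest_sub; first exact: sigma_algebra_measurable.
    move=> _ [A [mA ->]].
    rewrite (_ : mkset _ = \bigcap_(i in [set: 'I_m])
        ((fun x : 'rV[R]_m => x ord0 i) @^-1` A i)).
      apply: fin_bigcap_measurable => // i _.
      by rewrite -[X in measurable X]setTI; exact: measurable_coord.
    by apply/seteqP; split=> x /= H i; [move=> _|]; exact: H.
- move=> _ _ [A [mA ->]] [B [mB ->]]; exists (fun i => A i `&` B i); split.
    by move=> i; exact: measurableI.
  apply/seteqP; split=> x /=; first by move=> [Ax Bx] i; split.
  by move=> H; split=> i; have [] := H i.
- by apply/seteqP; split=> // x _; exists 0%N.
- by move=> _ [A [mA ->]]; exact: box.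
Qed.

Section brownian_increments.
Context d {Omega : measurableType d} {R : realType} (n : nat).
Variable X : R -> Omega -> 'rV[R]_n.

(** The coordinates of all the increments are flattened into a single vector,
    since it is on boxes that independence determines their joint law. *)
Definition increments (s : nat -> R) (N : nat) (w : Omega) : 'rV[R]_(N * n) :=
  mxvec (\matrix_(k < N, i < n) (X (s k.+1) w - X (s k) w) ord0 i).

Definition partial_position N (k : nat) (x : 'rV[R]_n) (y : 'rV[R]_(N * n))
    (i : 'I_n) : R :=
  x ord0 i + \sum_(j < N | (j < k)%N) vec_mx y j i.

(** Along a grid starting at time $0$ the sum of the increments telescopes. *)
Lemma partial_positionE (s : nat -> R) N k w i : s 0%N = 0 -> (k <= N)%N ->
  partial_position k (X 0 w) (increments s N w) i = X (s k) w ord0 i.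
Proof.
move=> s0 kN; rewrite /partial_position /increments.
under eq_bigr do rewrite mxvecK mxE.
rewrite -(big_ord_widen _ (fun j => (X (s j.+1) w - X (s j) w) ord0 i))//.
under eq_bigr do rewrite !mxE.
rewrite -(big_mkord xpredT (fun j => X (s j.+1) w ord0 i - X (s j) w ord0 i)).
rewrite telescope_sumr// s0 addrC subrK//.
Qed.

Lemma measurable_increments (P : probability Omega R) x (s : nat -> R) N :
  brownian_motion P X x -> (forall j, 0 <= s j) ->
  measurable_fun setT (increments s N).
Proof.
move=> [mX _ _ _ _] s0; apply: measurable_fun_rV => l.
case/mxvec_indexP: l => k i; rewrite /increments.
under eq_fun do rewrite mxvecE !mxE.
by apply: measurable_funB; apply: (measurableT_comp (measurable_coord i));
  exact: mX.
Qed.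

(** The product over [k] comes from the independence of the increments, the one
    over [i] from the independence of the coordinates of each of them; the
    starting point [x] has disappeared. *)
Lemma increments_box (P : probability Omega R) x (s : nat -> R) N
    (A : 'I_(N * n) -> set R) :
  brownian_motion P X x -> 0 <= s 0%N ->
  {homo s : i j / (i < j)%N >-> i < j} -> (forall l, measurable (A l)) ->
  P (increments s N @^-1` [set y : 'rV[R]_(N * n) | forall l, A l (y ord0 l)]) =
  (\prod_(k < N) \prod_(i < n)
    normal_prob 0 (Num.sqrt (s k.+1 - s k)) (A (mxvec_index k i)))%E.
Proof.
move=> [_ _ _ indep gauss] s0 smono mA.
have sge0 j : 0 <= s j.
  by case: j => [//|j]; rewrite (le_trans s0)// ltW// smono.
pose B (k : 'I_N) := [set v : 'rV[R]_n | forall i, A (mxvec_index k i) (v ord0 i)].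
have BE k : B k = \bigcap_(i in [set: 'I_n])
    ((fun x : 'rV[R]_n => x ord0 i) @^-1` A (mxvec_index k i)).
  by apply/seteqP; split=> v /= H i; [move=> _|]; exact: H.
have mB k : measurable (B k).
  rewrite BE; apply: fin_bigcap_measurable => // i _.
  by rewrite -[X in measurable X]setTI; exact: measurable_coord.
transitivity (P (\bigcap_(k in [set: 'I_N]) ((fun w => X (s k.+1) w - X (s k) w) @^-1` B k))).
  congr (P _); apply/seteqP; split=> w /= H.
    by move=> k _ i; have := H (mxvec_index k i); rewrite /increments mxvecE mxE.
  move=> l; case/mxvec_indexP: l => k i.
  by rewrite /increments mxvecE mxE; exact: (H k I).
rewrite (indep N s s0 smono B mB); apply: eq_bigr => k _.
have skk : 0 <= s k < s k.+1 by rewrite sge0 smono.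
have [ind1 law1] := gauss _ _ skk.
rewrite (_ : _ @^-1` B k = \bigcap_i ((fun w => (X (s k.+1) w - X (s k) w) ord0 i)
   @^-1` A (mxvec_index k i))); last first.
  by apply/seteqP; split=> w /= H i; [move=> _|]; exact: H.
rewrite ind1//; apply: eq_bigr => i _; exact: law1.
Qed.

Lemma increments_same_law (P Q : probability Omega R) x y (s : nat -> R) N
    (f : 'rV[R]_(N * n) -> \bar R) :
  brownian_motion P X x -> brownian_motion Q X y -> 0 <= s 0%N ->
  {homo s : i j / (i < j)%N >-> i < j} ->
  measurable_fun setT f -> (forall z, 0 <= f z)%E ->
  (\int[P]_w f (increments s N w) = \int[Q]_w f (increments s N w))%E.
Proof.
move=> BP BQ s0 smono mf f0.
have sge0 j : 0 <= s j.
  by case: j => [//|j]; rewrite (le_trans s0)// ltW// smono.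
have mY := measurable_increments (N := N) BP sge0.
pose mixin := isMeasurableFun.Build _ _ _ _ _ mY.
pose Y : {mfun Omega >-> 'rV[R]_(N * n)} := HB.pack (increments s N) mixin.
have push (M : probability Omega R) :
    (\int[M]_w f (increments s N w) = \int[pushforward M Y]_z f z)%E.
  by rewrite ge0_integral_pushforward.
rewrite !push; apply: eq_measure_integral => A mA _.
apply: (rV_measure_unique (mu := pushforward P Y) (nu := pushforward Q Y)) => //.
  by rewrite /= /pushforward preimage_setT probability_setT ltry.
move=> B mB; rewrite /= /pushforward.
by rewrite (increments_box BP)// (increments_box BQ).
Qed.

End brownian_increments.

(** * Gaussian moments and Riemann sums of the Feynman-Kac weight *)

Section gaussian_moment.
Context d {Omega : measurableType d} {R : realType}.

Lemma normal_pdf_tilt (s x : R) : 0 < s ->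
  expR (x ^+ 2 / (4 * s)) * normal_pdf 0 (Num.sqrt s) x =
  Num.sqrt 2 * normal_pdf 0 (Num.sqrt (2 * s)) x.
Proof.
move=> s0; have s20 : 0 < 2 * s by rewrite mulr_gt0.
rewrite !normal_pdfE ?gt_eqF ?sqrtr_gt0//.
rewrite /normal_peak /normal_fun !sqr_sqrtr ?ltW// !subr0 mulrCA -expRD.
have -> : x ^+ 2 / (4 * s) + - x ^+ 2 / (s *+ 2) = - x ^+ 2 / (2 * s *+ 2).
  by field; rewrite gt_eqF.
rewrite mulrA; congr (_ * _).
have -> : 2 * s * pi *+ 2 = 2 * (s * pi *+ 2) by ring.
rewrite sqrtrM// invfM mulrA divff ?mul1r// gt_eqF// sqrtr_gt0.
Qed.

(** Tilting the Gaussian density of variance $s$ by $e^{y^2/(4s)}$ doubles the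
    variance and multiplies the mass by $\sqrt2$. *)
Lemma expectation_expR_sqr_normal_le (P : probability Omega R) (Y : Omega -> R)
    (s t : R) : 0 < s -> s <= t -> measurable_fun setT Y ->
  (forall A, measurable A -> P [set w | A (Y w)] = normal_prob 0 (Num.sqrt s) A) ->
  (\int[P]_w (expR (Y w ^+ 2 / (4 * t)))%:E <= 2%:E)%E.
Proof.
move=> s0 st mY lawY; have t0 : 0 < t by rewrite (lt_le_trans s0).
have mY' : measurable_fun setT (Y : Omega -> measurableTypeR R) := mY.
pose mixin := isMeasurableFun.Build _ _ _ _ _ mY'.
pose Y' : {mfun Omega >-> measurableTypeR R} := HB.pack Y mixin.
have mf (c : R) : measurable_fun [set: measurableTypeR R] (fun y => (expR (y ^+ 2 / c))%:E).
  apply/measurable_EFinP; apply: measurableT_comp => //.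
  by apply: measurable_funM => //; exact: exprn_measurable.
have -> : (\int[P]_w (expR (Y w ^+ 2 / (4 * t)))%:E =
    \int[pushforward P Y']_y (expR (y ^+ 2 / (4 * t)))%:E)%E.
  by rewrite ge0_integral_pushforward// => y _; rewrite lee_fin expR_ge0.
have -> : (\int[pushforward P Y']_y (expR (y ^+ 2 / (4 * t)))%:E =
    \int[normal_prob 0 (Num.sqrt s)]_y (expR (y ^+ 2 / (4 * t)))%:E)%E.
  by apply: eq_measure_integral => A mA _; exact: lawY.
have f0 (y : measurableTypeR R) : (0 <= (expR (y ^+ 2 / (4 * t)))%:E)%E.
  by rewrite lee_fin expR_ge0.
rewrite (ge0_integral_density (mu := lebesgue_measure)
  (nu := normal_prob 0 (Num.sqrt s))
  (@measurable_normal_pdf R 0 (Num.sqrt s)) (normal_pdf_ge0 0 (Num.sqrt s))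
  (fun _ _ => erefl) (mf _) f0).
have mpdf (c : R) : measurable_fun [set: measurableTypeR R] (fun x => (normal_pdf 0 c x)%:E).
  by apply/measurable_EFinP; exact: measurable_normal_pdf.
apply: (@le_trans _ _ (\int[lebesgue_measure]_x
    ((Num.sqrt 2)%:E * (normal_pdf 0 (Num.sqrt (2 * s)) x)%:E))%E).
  apply: ge0_le_integral => //.
  - by move=> x _; rewrite mule_ge0// lee_fin ?expR_ge0 ?normal_pdf_ge0.
  - by apply: emeasurable_funM; [exact: mf|exact: mpdf].
  - by apply: emeasurable_funM => //; exact: mpdf.
  - move=> x _; rewrite -!EFinM lee_fin -normal_pdf_tilt//.
    rewrite ler_wpM2r ?normal_pdf_ge0// ler_expR ler_wpM2l ?sqr_ge0//.
    by rewrite lef_pV2 ?posrE ?mulr_gt0// ler_pM2l.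
rewrite (ge0_integralZl _ _ (mpdf _))//; last first.
  by move=> x _; rewrite lee_fin normal_pdf_ge0.
rewrite integral_normal_pdf mule1 lee_fin.
apply: (@le_trans _ _ (Num.sqrt (2 ^+ 2))); last by rewrite sqrtr_sqr ger0_norm.
by rewrite ler_sqrt// -natrX ler_nat.
Qed.

End gaussian_moment.

Section riemann_weight.
Context d {Omega : measurableType d} {R : realType} (n : nat).
Variables (X : R -> Omega -> 'rV[R]_n) (alpha t : R).

Definition sum_v (z : 'I_n -> R) : R := \sum_(i < n) v_ alpha (z i).

Definition time (N k : nat) : R := k%:R * (t / N.+1%:R).

(** The Riemann sum has [N.+1] terms, at the left endpoints of the grid, so that
    the mesh is never a division by zero. *)
Definition riemann_weight (N : nat) (w : Omega) : R :=
  expR (2^-1 * (t / N.+1%:R * \sum_(k < N.+1) sum_v (X (time N k) w ord0))).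

Lemma time_ge0 N k : 0 < t -> 0 <= time N k.
Proof. by move=> t0; rewrite mulr_ge0// divr_ge0// ltW. Qed.

Lemma continuous_path_norm w i : {within `[0, +oo[, continuous (X ^~ w)} ->
  continuous (fun s : R => X `|s| w ord0 i).
Proof.
move=> /subspace_continuousP cX s.
have A (s' : R) : `[0, +oo[%classic (`|s'| : R) by rewrite /= in_itv/= normr_ge0.
have normc : (fun r : R => `|r|) @ s --> within `[0, +oo[ (nbhs `|s|).
  move=> B; rewrite /within/= => nB.
  have H : nbhs s (fun r : R => `[0, +oo[%classic (`|r| : R) -> B `|r|) :=
    @norm_continuous _ R^o s _ nB.
  have H' : nbhs s (fun r : R => B `|r|) by apply: filterS H => r; exact.
  exact: H'.
have h := cvg_comp _ _ normc (cX _ (A s)).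
exact: (cvg_comp _ _ h (@coord_continuous _ _ _ ord0 i _)).
Qed.

(** A path is extended evenly to negative times so as to be continuous on the
    whole line. *)
Lemma riemann_weight_cvg w : 0 < t -> {within `[0, +oo[, continuous (X ^~ w)} ->
  riemann_weight N w @[N --> \oo] --> feynman_kac_weight X (U_ alpha) t w.
Proof.
move=> t0 cX; pose g (s : R) := sum_v (X `|s| w ord0).
have cg : continuous g.
  move=> s; rewrite /g /sum_v; apply: cvg_big => [|i _].
    by move=> z; exact: add_continuous.
  apply: (@continuous_comp _ _ _ (fun s : R => X `|s| w ord0 i) (v_ alpha)).
    exact: continuous_path_norm.
  exact: continuous_v.
rewrite /feynman_kac_weight.
have -> : \int[lebesgue_measure]_(s in `[0, t])
    (laplacian (U_ alpha) (X s w) - sqnorm_grad (U_ alpha) (X s w)) =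
    \int[lebesgue_measure]_(s in `[0, t]) g s.
  apply: eq_Rintegral => s; rewrite inE /= in_itv/= => /andP[s0 _].
  by rewrite laplacian_sub_sqnorm_grad_U /g ger0_norm.
apply: (cvg_comp _ expR); last exact: continuous_expR.
apply: cvgM; first exact: cvg_cst.
rewrite [X in X @ _ --> _](_ : _ = fun N => t / N.+1%:R *
    \sum_(k < N.+1) g (k%:R * (t / N.+1%:R))); first exact: riemann_sum_cvg.
apply/funext => N; congr (_ * _); apply: eq_bigr => k _.
by rewrite /g ger0_norm//; exact: time_ge0.
Qed.

Lemma measurable_v : measurable_fun setT (v_ alpha).
Proof. by apply: continuous_measurable_fun; exact: continuous_v. Qed.

Lemma measurable_riemann_weight N : 0 < t ->
  (forall s, 0 <= s -> measurable_fun setT (X s)) ->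
  measurable_fun setT (riemann_weight N).
Proof.
move=> t0 mX; apply: measurableT_comp => //; apply: measurable_funM => //.
apply: measurable_funM => //; apply: measurable_sum => k.
apply: measurable_sum => i; apply: (measurableT_comp measurable_v).
by apply: (measurableT_comp (measurable_coord i)); apply: mX; exact: time_ge0.
Qed.

Lemma riemann_weight_le N w : 1 < alpha -> alpha < 2 -> 0 < t ->
  riemann_weight N w <= expR (2^-1 * (t * (n%:R * 6))).
Proof.
move=> alpha1 alpha2 t0; rewrite ler_expR ler_pM2l// -mulrA ler_pM2l//.
rewrite mulrC ler_pdivrMr// [leRHS]mulr_natr.
have le6 k : sum_v (X (time N k) w ord0) <= n%:R * 6.
  rewrite mulr_natl -[X in _ *+ X](card_ord n) -sumr_const.
  apply: ler_sum => i _; rewrite (le_trans (v_le _ _ _))//.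
  by rewrite gerBl mulr_ge0 ?sqr_ge0 ?powR_ge0.
rewrite -[X in _ *+ X](card_ord N.+1) -sumr_const.
by apply: ler_sum.
Qed.

End riemann_weight.

(** * The expectation of the weight as a function of the starting point *)

Section weight_expectation.
Context d {Omega : measurableType d} {R : realType} (n : nat).
Variables (X : R -> Omega -> 'rV[R]_n) (alpha t : R).

(** The Riemann sum as a function of the starting point and of the increments,
    with no reference to the probability space. *)
Definition riemann_weight_from N (x : 'rV[R]_n) (y : 'rV[R]_(N.+1 * n)) : R :=
  expR (2^-1 * (t / N.+1%:R *
    \sum_(k < N.+1) sum_v alpha (partial_position k x y))).

Lemma riemann_weight_fromE N w :
  riemann_weight_from (X 0 w) (increments X (time t N) N.+1 w) =
  riemann_weight X alpha t N w.
Proof.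
congr (expR (_ * (_ * _))); apply: eq_bigr => k _; apply: eq_bigr => i _.
by rewrite partial_positionE ?/time ?mul0r// ltnW.
Qed.

Lemma measurable_vec_mx m k (l : 'I_m) (i : 'I_k) :
  measurable_fun setT (fun y : 'rV[R]_(m * k) => vec_mx y l i).
Proof.
rewrite (_ : (fun _ => _) = (fun y : 'rV[R]_(m * k) => y ord0 (mxvec_index l i))).
  exact: measurable_coord.
by apply/funext => y; rewrite mxE.
Qed.

Lemma measurable_riemann_weight_from N :
  measurable_fun setT
    (fun p : 'rV[R]_n * 'rV[R]_(N.+1 * n) => riemann_weight_from p.1 p.2).
Proof.
apply: measurableT_comp => //; apply: measurable_funM => //.
apply: measurable_funM => //; apply: measurable_sum => k.
apply: measurable_sum => i; apply: (measurableT_comp (measurable_v alpha)).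
apply: measurable_funD.
  exact: (measurableT_comp (measurable_coord i) measurable_fst).
rewrite (_ : (fun _ => _) = (fun p : 'rV[R]_n * 'rV[R]_(N.+1 * n) =>
    \sum_(j < N.+1) (if (j < k)%N then vec_mx p.2 j i else 0))).
  apply: measurable_sum => j; case: (j < k)%N => //.
  exact: (measurableT_comp (measurable_vec_mx j i) measurable_snd).
by apply/funext => p; rewrite big_mkcond.
Qed.

Lemma time_homo N : 0 < t -> {homo time t N : i j / (i < j)%N >-> i < j}.
Proof. by move=> t0 i j ij; rewrite ltr_pM2r ?divr_gt0// ltr_nat. Qed.

(** The law of the increments does not depend on the starting point, so that
    all the expectations can be computed under a single probability, with the
    starting point as a parameter. *)
Lemma riemann_weight_expectation (P Q : probability Omega R) x y N :
  0 < t -> brownian_motion P X x -> brownian_motion Q X y ->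
  (\int[P]_w (riemann_weight X alpha t N w)%:E =
   \int[Q]_w (riemann_weight_from x (increments X (time t N) N.+1 w))%:E)%E.
Proof.
move=> t0 BP BQ; have [mX X0 _ _ _] := BP.
have time0 : 0 <= time t N 0 by exact: time_ge0.
have mfrom : measurable_fun setT (fun z => (riemann_weight_from (N := N) x z)%:E).
  apply/measurable_EFinP.
  by have := measurableT_comp (@measurable_riemann_weight_from N)
    (pair1_measurable x).
rewrite -(increments_same_law BP BQ time0 (time_homo N t0) mfrom); last first.
  by move=> z; rewrite lee_fin expR_ge0.
apply: ae_eq_integral => //.
- by apply/measurable_EFinP; exact: measurable_riemann_weight.
- apply: (measurableT_comp mfrom).
  by apply: (measurable_increments (N := N.+1) BP) => j; exact: time_ge0.
- apply: filterS X0 => w Xw _; by rewrite -riemann_weight_fromE Xw.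
Qed.

Lemma measurable_feynman_kac_weight (P : probability Omega R) x :
  0 < t -> brownian_motion P X x ->
  measurable_fun setT (feynman_kac_weight X (U_ alpha) t).
Proof.
move=> t0 [mX _ cX _ _].
apply: (measurable_fun_cvg (fun N => measurable_riemann_weight alpha N t0 mX)).
by move=> w _; exact: riemann_weight_cvg.
Qed.

(** Dominated convergence with a constant bound, [v_] being bounded above. *)
Lemma weight_expectation_cvg (P : probability Omega R) x :
  1 < alpha -> alpha < 2 -> 0 < t -> brownian_motion P X x ->
  (\int[P]_w (riemann_weight X alpha t N w)%:E @[N --> \oo] -->
   \int[P]_w (feynman_kac_weight X (U_ alpha) t w)%:E)%E.
Proof.
move=> alpha1 alpha2 t0 BP; have [mX _ cX _ _] := BP.
have mT : measurable [set: Omega] by [].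
pose K := expR (2^-1 * (t * (n%:R * 6))) : R.
have [] := @dominated_convergence _ _ _ P _ mT
  (fun N w => (riemann_weight X alpha t N w)%:E)
  (fun w => (feynman_kac_weight X (U_ alpha) t w)%:E) (EFin \o cst K).
- by move=> N; apply/measurable_EFinP; exact: measurable_riemann_weight.
- by apply/measurable_EFinP; exact: measurable_feynman_kac_weight BP.
- by apply: aeW => w _; apply: cvg_EFin; [exact: nearW|exact: riemann_weight_cvg].
- exact: finite_measure_integrable_cst.
- apply: aeW => w N _; rewrite /= lee_fin ger0_norm ?expR_ge0//.
  exact: riemann_weight_le.
- by move=> _ _.
Qed.

End weight_expectation.

Lemma measurable_weight_expectation d {Omega : measurableType d} {R : realType}
    n (P : 'rV[R]_n -> probability Omega R) (X : R -> Omega -> 'rV[R]_n)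
    (alpha t : R) :
  1 < alpha -> alpha < 2 -> 0 < t -> (forall x, brownian_motion (P x) X x) ->
  measurable_fun setT
    (fun x => \int[P x]_w (feynman_kac_weight X (U_ alpha) t w)%:E)%E.
Proof.
move=> alpha1 alpha2 t0 BP.
apply: (emeasurable_fun_cvg
  (fun N x => \int[P x]_w (riemann_weight X alpha t N w)%:E)%E); last first.
  by move=> x _; exact: weight_expectation_cvg (BP x).
move=> N.
under eq_fun do rewrite (riemann_weight_expectation _ _ t0 (BP _) (BP 0)).
apply: (measurable_fun_fubini_tonelli_F (m2 := P 0) (fun p : 'rV[R]_n * Omega =>
  (riemann_weight_from alpha t p.1 (increments X (time t N) N.+1 p.2))%:E)).
  apply/measurable_EFinP.
  have mG : measurable_fun setT (fun p : 'rV[R]_n * Omega =>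
      (p.1, increments X (time t N) N.+1 p.2)).
    apply: measurable_fun_pair => //=.
    apply: (measurableT_comp _ measurable_snd).
    by apply: (measurable_increments (N := N.+1) (BP 0)) => j; exact: time_ge0.
  exact: (measurableT_comp (@measurable_riemann_weight_from R n alpha t N) mG).
by move=> p; rewrite lee_fin expR_ge0.
Qed.

(** * Decay of the expectation of the weight *)

Section weight_bound.
Context d {Omega : measurableType d} {R : realType} (n : nat).
Variables (X : R -> Omega -> 'rV[R]_n) (alpha t : R).

(** The exponent of the Feynman-Kac weight is compared with its value along the
    constant path at $x$, with $\alpha^2$ weakened to $a$. The displacement $y$
    contributes $O(|y|^\beta)$, and $\beta<2$ makes this at most
    $\frac{y^2}{4t}+C$, an exponent that Gaussian variables of variance at most
    $t$ can bear. *)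
Lemma v_perturb_le (a c : R) : 1 < alpha -> alpha < 2 -> 0 < t -> 0 <= c ->
  0 < a -> a < alpha ^+ 2 -> exists C : R, forall x y : R,
  c * v_ alpha (x + y) <=
    C - c * a * `|x| `^ (2 * (alpha - 1)) + y ^+ 2 / (4 * t).
Proof.
move=> alpha1 alpha2 t0 c0 a0 aalpha; set be := 2 * (alpha - 1).
have be0 : 0 < be by rewrite /be; lra.
have be2 : be < 2 by rewrite /be; lra.
have al2 : 0 < alpha ^+ 2 by rewrite exprn_gt0// (lt_trans ltr01).
(* the perturbation must multiply the main term by exactly $a/\alpha^2$ *)
pose r := a / alpha ^+ 2.
have r0 : 0 < r by rewrite divr_gt0.
have r1 : r < 1 by rewrite ltr_pdivrMr// mul1r.
have rb1 : r `^ be^-1 < 1.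
  have := @gt0_ltr_powR _ be^-1 _ r 1; rewrite powR1 !nnegrE invr_gt0 be0.
  by rewrite ler01 (ltW r0); apply.
have rb0 : 0 < r `^ be^-1 by exact: powR_gt0.
pose eta := 1 - r `^ be^-1.
have eta0 : 0 < eta by rewrite subr_gt0.
have eta1 : eta < 1 by rewrite ltrBlDr ltrDl.
have etaE : (1 - eta) `^ be = r.
  by rewrite /eta opprB addrC subrK -powRrM mulVf ?gt_eqF// powRr1// ltW.
have B0 : 0 <= c * alpha ^+ 2 * eta^-1 `^ be.
  by apply: mulr_ge0; [apply: mulr_ge0 => //; exact: ltW|exact: powR_ge0].
have t4 : 0 < (4 * t)^-1 by rewrite invr_gt0 mulr_gt0.
have [C' HC] := powR_le_sqr (ltW be0) be2 B0 t4.
exists (c * 6 + C') => x y.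
have h1 := @v_le _ alpha (x + y) alpha1 alpha2; rewrite -/be in h1.
have h2 := @powR_norm_perturb _ be eta x y (ltW be0) eta0 eta1.
rewrite etaE in h2; have h3 := HC y.
have h4 : c * v_ alpha (x + y) <= c * (6 - alpha ^+ 2 * `|x + y| `^ be).
  by rewrite ler_wpM2l.
have h5 : c * alpha ^+ 2 * (r * `|x| `^ be) <=
    c * alpha ^+ 2 * (`|x + y| `^ be + eta^-1 `^ be * `|y| `^ be).
  by apply: ler_wpM2l => //; apply: mulr_ge0 => //; exact: ltW.
have rE : c * alpha ^+ 2 * (r * `|x| `^ be) = c * a * `|x| `^ be.
  by rewrite /r; field; rewrite gt_eqF// (lt_trans ltr01).
rewrite rE in h5; lra.
Qed.

Lemma expectation_displacement_le (P : probability Omega R) x N k i :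
  0 < t -> brownian_motion P X x -> (k < N.+1)%N ->
  (\int[P]_w (expR ((X (time t N k) w - X 0 w) ord0 i ^+ 2 / (4 * t)))%:E
   <= 2%:E)%E.
Proof.
move=> t0 [mX _ _ _ gauss] kN; have [k0|k0] := posnP k.
  rewrite k0 /time mul0r; under eq_integral do
    rewrite subrr mxE expr0n/= mul0r expR0.
  by rewrite integral_cst// mul1e (le_trans (probability_le1 P _))// lee_fin ler1n.
have s0 : 0 < time t N k by rewrite mulr_gt0 ?divr_gt0// ltr0n.
have st : time t N k <= t.
  rewrite /time mulrCA ler_piMr ?(ltW t0)//.
  by rewrite ler_pdivrMr// mul1r ler_nat ltnW.
have [|_ law] := gauss 0 (time t N k); first by rewrite lexx.
apply: (expectation_expR_sqr_normal_le
  (Y := fun w => (X (time t N k) w - X 0 w) ord0 i) s0 st).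
  under eq_fun do rewrite !mxE.
  apply: measurable_funB; apply: (measurableT_comp (measurable_coord i)).
    by apply: mX; exact: ltW.
  exact: mX.
by move=> A mA; have := law i A mA; rewrite subr0.
Qed.

(** The bound is proved for the Riemann sums, uniformly in [N], where Jensen's
    inequality applies to the uniform mean over the pairs (time, coordinate);
    the expectation of each exponential is at most [2]. *)
Lemma weight_expectation_le (a : R) : 1 < alpha -> alpha < 2 -> 0 < t ->
  (0 < n)%N -> 0 < a -> a < alpha ^+ 2 ->
  exists K : R, 0 < K /\ forall (P : probability Omega R) x,
    brownian_motion P X x ->
    (\int[P]_w (feynman_kac_weight X (U_ alpha) t w)%:E <=
     (K * expR (- (2^-1 * t * a *
       \sum_(i < n) `|x ord0 i| `^ (2 * (alpha - 1)))))%:E)%E.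
Proof.
move=> alpha1 alpha2 t0 n0 a0 aalpha.
have c0 : 0 <= 2^-1 * t * n%:R by rewrite !mulr_ge0// ltW.
have [C HC] := v_perturb_le alpha1 alpha2 t0 c0 a0 aalpha.
exists (expR C * 2); split; first by rewrite mulr_gt0// expR_gt0.
move=> P x BP; set S := \sum_(i < n) _.
apply: (cvge_le _ (weight_expectation_cvg alpha1 alpha2 t0 BP)).
apply: nearW => N.
have [mX X0 _ _ _] := BP.
pose I := ('I_N.+1 * 'I_n)%type.
have cI : #|{: I}| = (N.+1 * n)%N by rewrite card_prod !card_ord.
have cI0 : (0 < #|{: I}|)%N by rewrite cI muln_gt0.
pose q (p : I) w := (X (time t N p.1) w - X 0 w) ord0 p.2 ^+ 2 / (4 * t).
pose c := expR C * expR (- (2^-1 * t * a * S)).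
have c_ge0 : 0 <= c by rewrite mulr_ge0 ?expR_ge0.
have mq p : measurable_fun setT (fun w => (expR (q p w))%:E).
  apply/measurable_EFinP; apply: measurableT_comp => //.
  apply: measurable_funM => //.
  apply: (measurableT_comp (exprn_measurable 2)).
  under eq_fun do rewrite !mxE.
  by apply: measurable_funB; apply: (measurableT_comp (measurable_coord p.2));
    apply: mX => //; exact: time_ge0.
have sum0 w : (0 <= \sum_(p : I) (expR (q p w))%:E)%E.
  by apply: sume_ge0 => p _; rewrite lee_fin expR_ge0.
have path w : X 0 w = x -> riemann_weight X alpha t N w <=
    c * (#|{: I}|%:R^-1 * \sum_p expR (q p w)).
  move=> Xw; rewrite /c -expRD.
  apply: (@le_trans _ _ (expR (C - 2^-1 * t * a * S) *
    expR (#|{: I}|%:R^-1 * \sum_p q p w))); last first.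
    by rewrite ler_wpM2l ?expR_ge0// expR_mean_le.
  rewrite -expRD ler_expR /sum_v.
  have IE : #|{: I}|%:R = N.+1%:R * n%:R :> R by rewrite cI natrM.
  have n0' : n%:R != 0 :> R by rewrite pnatr_eq0 -lt0n.
  have N0' : N.+1%:R != 0 :> R by rewrite pnatr_eq0.
  have I0' : 0 < #|{: I}|%:R :> R by rewrite ltr0n.
  rewrite pair_bigA/=.
  have -> : 2^-1 * (t / N.+1%:R *
      \sum_(p : I) v_ alpha (X (time t N p.1) w ord0 p.2)) =
      #|{: I}|%:R^-1 *
      \sum_(p : I) 2^-1 * t * n%:R * v_ alpha (X (time t N p.1) w ord0 p.2).
    by rewrite -mulr_sumr IE; field; rewrite n0' addrC natr1 N0'.
  rewrite mulrC ler_pdivrMr//.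
  apply: (@le_trans _ _ (\sum_(p : I)
      (C - 2^-1 * t * n%:R * a * `|x ord0 p.2| `^ (2 * (alpha - 1)) + q p w))).
    apply: ler_sum => p _; rewrite /q.
    have -> : X (time t N p.1) w ord0 p.2 = x ord0 p.2 +
        (X (time t N p.1) w - X 0 w) ord0 p.2.
      by rewrite Xw !mxE [RHS]addrC subrK.
    exact: HC.
  rewrite big_split/= sumrB sumr_const -mulr_sumr.
  rewrite -(pair_bigA _ (fun k i => `|x ord0 i| `^ (2 * (alpha - 1))))/=.
  rewrite -/S sumr_const card_ord; set Q := \sum_(p : I) q p w.
  rewrite (_ : C *+ _ = C * #|{: I}|%:R); last by rewrite mulr_natr.
  rewrite mulrDl [_^-1 * Q * _]mulrAC mulVf ?gt_eqF// mul1r lerD2r IE.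
  by rewrite -[S *+ _]mulr_natr; rewrite le_eqVlt; apply/orP; left; apply/eqP; ring.
apply: (@le_trans _ _ (\int[P]_w (c%:E * ((#|{: I}|%:R^-1)%:E *
    \sum_p (expR (q p w))%:E)))%E).
  apply: ae_ge0_le_integral => //.
  - by move=> w _; rewrite lee_fin expR_ge0.
  - by apply/measurable_EFinP; exact: measurable_riemann_weight.
  - by move=> w _; apply: mule_ge0 => //; apply: mule_ge0 => //; exact: sum0.
  - apply: measurable_funeM; apply: measurable_funeM.
    exact: emeasurable_sum.
  - apply: filterS X0 => w Xw _.
    by rewrite sumEFin -!EFinM lee_fin; exact: path.
have msum : measurable_fun setT (fun w => \sum_p (expR (q p w))%:E)%E.
  exact: emeasurable_sum.
rewrite ge0_integralZl//; last 2 first.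
- exact: measurable_funeM.
- by move=> w _; rewrite mule_ge0// lee_fin.
rewrite ge0_integralZl// ge0_integral_sum//.
apply: (@le_trans _ _ (c%:E * ((#|{: I}|%:R^-1)%:E * \sum_(p : I) 2%:E))%E).
  rewrite lee_wpmul2l ?lee_fin// lee_wpmul2l ?lee_fin//.
  by apply: lee_sum => p _; exact: expectation_displacement_le BP _.
rewrite sumEFin sumr_const -!EFinM lee_fin -[2 *+ _]mulr_natl.
rewrite mulKf ?pnatr_eq0 -?lt0n// /c.
by rewrite mulrAC.
Qed.

End weight_bound.

(** * Growth of the Young function *)

Section growth_of_psi.
Context {R : realType}.

(** Since $\psi$ is non-decreasing, the integrability of
    $\psi(e^{x^\alpha})e^{-dtx^\beta}$ on the interval from $r$ to $\lambda r$
    controls the value of $\psi$ at $e^{r^\alpha}$; letting $\lambda$ be close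
    to $1$ costs an arbitrarily small increase of $d$. *)
Lemma psi_expR_le (alpha t d A : R) (psi : R -> R) :
  1 < alpha -> alpha < 2 -> 0 < t -> d < alpha ^+ 2 ->
  (forall y, 0 < y -> 0 < psi y) ->
  (forall x y, 0 < x -> x <= y -> psi x <= psi y) ->
  lebesgue_measure.-integrable `[A, +oo[
    (fun x => (psi (expR (`|x| `^ alpha)) *
       expR (- d * t * `|x| `^ (2 * (alpha - 1))))%:E) ->
  exists b C y0 : R, [/\ 0 < b, b < alpha ^+ 2 &
    forall y, y0 <= y -> 0 <= y ->
      psi (expR y) <= C * expR (b * t * y `^ (2 * (alpha - 1) / alpha))].
Proof.
move=> alpha1 alpha2 t0 dalpha psi0 psimono; set be := 2 * (alpha - 1).
set phi := fun x : R => psi (expR (`|x| `^ alpha)) * expR (- d * t * `|x| `^ be).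
move=> iphi.
have be0 : 0 < be by rewrite /be; lra.
have alpha0 : 0 < alpha by rewrite (lt_trans ltr01).
have al2 : 0 < alpha ^+ 2 by rewrite exprn_gt0.
(* [d'] is positive, so that [b / d'] makes sense; [lam] is chosen to turn [d']
   into [b]. *)
pose d' := Num.max d (alpha ^+ 2 / 2).
have d'0 : 0 < d' by rewrite lt_max [X in _ || X]divr_gt0// orbT.
have dd' : d <= d' by rewrite le_max lexx.
have d'alpha : d' < alpha ^+ 2 by rewrite gt_max dalpha/=; lra.
pose b := (d' + alpha ^+ 2) / 2.
have d'b : d' < b by rewrite /b; lra.
have b0 : 0 < b by rewrite (lt_trans d'0).
pose lam := (b / d') `^ be^-1.
have bd1 : 1 < b / d' by rewrite ltr_pdivlMr// mul1r.
have lam1 : 1 < lam.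
  have := @gt0_ltr_powR _ be^-1 _ 1 (b / d'); rewrite powR1 !nnegrE invr_gt0 be0.
  by rewrite ler01 (ltW (lt_trans ltr01 bd1)); apply.
have lam0 : 0 < lam by rewrite (lt_trans ltr01).
have lamE : d' * lam `^ be = b.
  rewrite /lam -powRrM mulVf ?gt_eqF// powRr1 ?ltW ?(lt_trans ltr01)//.
  by rewrite mulrC divfK// gt_eqF.
have [mphi Iphi] := integrableP _ _ _ iphi.
pose I : \bar R := (\int[lebesgue_measure]_(x in `[A, +oo[) `|(phi x)%:E|)%E.
rewrite -/I in Iphi.
have I0 : (0 <= I)%E by exact: integral_ge0.
have Ifin : I = (fine I)%:E by rewrite fineK// ge0_fin_numE.
pose r0 := Num.max A 1.
(* beyond $r_0\ge1$ the interval $[r,\lambda r]$ has length at least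
   $\lambda-1$ *)
exists b, (fine I / (lam - 1)), (r0 `^ alpha); split => //.
  by rewrite /b; lra.
move=> y y0 y_ge0; pose r := y `^ alpha^-1.
have rA : r `^ alpha = y by rewrite /r -powRrM mulVf ?gt_eqF// powRr1.
have r_ge0 : 0 <= r by exact: powR_ge0.
have r00 : 0 <= r0 by rewrite le_max ler01 orbT.
have rr0 : r0 <= r.
  rewrite leNgt; apply/negP => rr0.
  have := @gt0_ltr_powR _ alpha alpha0 r r0; rewrite !nnegrE => /(_ r_ge0 r00 rr0).
  by rewrite rA ltNge y0.
have r1 : 1 <= r by rewrite (le_trans _ rr0)// le_max lexx orbT.
have Ar : A <= r by rewrite (le_trans _ rr0)// le_max lexx.
have rb : y `^ (be / alpha) = r `^ be by rewrite /r -powRrM mulrC.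
rewrite rb -[in leLHS]rA.
have rlam : r <= lam * r by rewrite ler_peMl// ltW.
pose k := psi (expR (r `^ alpha)) * expR (- d' * t * (lam * r) `^ be).
have k0 : 0 < k by rewrite mulr_gt0 ?expR_gt0// psi0// expR_gt0.
have kphi x : r <= x -> x <= lam * r -> k <= phi x.
  move=> rx xr; have x0 : 0 <= x by rewrite (le_trans r_ge0).
  rewrite /k /phi (ger0_norm x0); apply: ler_pM.
  - by rewrite ltW// psi0// expR_gt0.
  - exact: expR_ge0.
  - apply: psimono; first exact: expR_gt0.
    by rewrite ler_expR; apply: (@ge0_ler_powR _ _ (ltW alpha0)); rewrite ?nnegrE.
  - rewrite ler_expR !mulNr lerN2 -!mulrA.
    have h : x `^ be <= (lam * r) `^ be.
      apply: (@ge0_ler_powR _ _ (ltW be0)); rewrite ?nnegrE//.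
      exact: le_trans xr.
    have tx : 0 <= t * x `^ be by rewrite mulr_ge0 ?powR_ge0// ltW.
    rewrite (le_trans (ler_wpM2r tx dd'))// ler_wpM2l ?(ltW d'0)//.
    by rewrite ler_wpM2l// ltW.
have rlr : (0 : R) <= lam * r - r by rewrite subr_ge0.
have kI : ((k * (lam * r - r))%:E <= I)%E.
  have h1 : ((k * (lam * r - r))%:E <=
      \int[lebesgue_measure]_(x in `[r, (lam * r)%R]) k%:E)%E.
    rewrite integral_cst//= lebesgue_measure_itv/= lte_fin -EFinB.
    case: ifPn => [_|]; first by rewrite -EFinM.
    rewrite -leNgt => lr; have -> : lam * r - r = 0.
      by apply/eqP; rewrite subr_eq0 eq_le lr rlam.
    by rewrite mulr0 mule0.
  have sub : `[r, lam * r]%classic `<=` `[A, +oo[%classic.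
    by move=> x /=; rewrite !in_itv/= andbT => /andP[rx _]; exact: le_trans rx.
  have mphi' : measurable_fun `[A, +oo[ (fun x => `|(phi x)%:E|%E).
    exact: measurableT_comp.
  apply: (le_trans h1).
  have h2 : (\int[lebesgue_measure]_(x in `[r, (lam * r)%R]) k%:E <=
      \int[lebesgue_measure]_(x in `[r, (lam * r)%R]) `|(phi x)%:E|)%E.
    apply: ge0_le_integral.
    - exact: measurable_itv.
    - by move=> x _; rewrite lee_fin ltW.
    - exact: measurable_cst.
    - exact: (measurable_funS _ sub mphi').
    - move=> x /=; rewrite in_itv/= => /andP[rx xr].
      by rewrite lee_fin (le_trans (kphi _ rx xr))// ler_norm.
  apply: (le_trans h2); exact: ge0_subset_integral.
have {}kI : k * (lam * r - r) <= fine I by rewrite -lee_fin -Ifin.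
have lam10 : 0 < lam - 1 by rewrite subr_gt0.
have klam : k <= fine I / (lam - 1).
  rewrite ler_pdivlMr// (le_trans _ kI)// ler_wpM2l ?(ltW k0)//.
  rewrite [leRHS](_ : _ = (lam - 1) * r); last by ring.
  by rewrite ler_peMr// ltW.
apply: le_trans (ler_wpM2r (expR_ge0 _) klam).
rewrite /k -[leRHS]mulrA -expRD powRM ?(ltW lam0)// -lamE.
have cancel (u v w : R) : - u * t * (v * w) + u * v * t * w = 0 by ring.
by rewrite cancel expR0 mulr1.
Qed.

End growth_of_psi.

(** * Integrability over the whole space *)

Section integrability.
Context {R : realType}.

(** One term of the exponential series, of order at least $2/\beta$, already
    dominates $x^2$. *)
Lemma oneDsqr_le_expR_powR (c be : R) : 0 < c -> 0 < be ->
  exists C : R, 0 < C /\ forall x : R, 1 + x ^+ 2 <= C * expR (c * `|x| `^ be).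
Proof.
move=> c0 be0; pose m := Num.bound (2 / be).
have mbe : 2 <= be * m.+1%:R.
  have : 2 / be < m%:R by rewrite archi_boundP// divr_ge0// ltW.
  rewrite ltr_pdivrMr// mulrC => /ltW/le_trans; apply.
  by rewrite ler_pM2l// ler_nat.
pose D : R := m.+1`!%:R / c ^+ m.+1.
have D0 : 0 < D by rewrite divr_gt0 ?exprn_gt0// ltr0n fact_gt0.
exists (2 + D); split; first by rewrite addr_gt0.
move=> x; have p0 : 0 <= c * `|x| `^ be by rewrite mulr_ge0 ?powR_ge0// ltW.
have e1 : 1 <= expR (c * `|x| `^ be) by rewrite -[leLHS]expR0 ler_expR.
have e0 := expR_ge0 (c * `|x| `^ be).
have [x1|x1] := leP `|x| 1.
  have : x ^+ 2 <= 1 by rewrite -real_normK ?num_real// expr_le1.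
  move=> x21; rewrite mulrDl.
  have De : 0 <= D * expR (c * `|x| `^ be) by rewrite mulr_ge0// ltW.
  lra.
have x2 : x ^+ 2 <= (`|x| `^ be) ^+ m.+1.
  rewrite -(@powR_mulrn _ (`|x| `^ be)) ?powR_ge0// -powRrM -real_normK ?num_real//.
  by rewrite -powR_mulrn//; apply: ler_powR => //; exact: ltW.
have := @expR_ge1Dxn _ _ m p0; rewrite exprMn => h.
have h2 : (`|x| `^ be) ^+ m.+1 <= D * expR (c * `|x| `^ be).
  rewrite /D mulrAC ler_pdivlMr ?exprn_gt0// mulrC [leRHS]mulrC.
  rewrite -ler_pdivrMr ?ltr0n ?fact_gt0//.
  by apply: le_trans h; rewrite lerDr.
rewrite mulrDl; lra.
Qed.

Lemma integral_oneDsqrV_lty :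
  (\int[lebesgue_measure]_x ((oneDsqr (x : R))^-1)%:E < +oo)%E.
Proof.
rewrite (ge0_symfun_integralT (f := fun x : R => (oneDsqr x)^-1)).
- by rewrite -set_itvcy integral0y_oneDsqr -EFinM ltry.
- by move=> x; rewrite invr_ge0.
- exact: continuous_oneDsqrV.
- by move=> x /=; rewrite /oneDsqr sqrrN.
Qed.

Lemma integral_expRN_powR_lty (c be : R) : 0 < c -> 0 < be ->
  (\int[lebesgue_measure]_x (expR (- (c * `|x : R| `^ be)))%:E < +oo)%E.
Proof.
move=> c0 be0; have [C [C0 HC]] := oneDsqr_le_expR_powR c0 be0.
have mV : measurable_fun setT (fun x : measurableTypeR R => ((oneDsqr x)^-1)%:E).
  apply/measurable_EFinP; apply: continuous_measurable_fun.
  exact: continuous_oneDsqrV.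
apply: (@le_lt_trans _ _
  (\int[lebesgue_measure]_x (C%:E * ((oneDsqr (x : R))^-1)%:E))%E).
  apply: ge0_le_integral => //.
  - apply/measurable_EFinP; apply: measurableT_comp => //.
    apply: measurableT_comp => //; apply: measurable_funM => //.
    exact: (measurableT_comp (measurable_powR be)).
  - exact: measurable_funeM.
  - move=> x _; rewrite -EFinM lee_fin expRN ler_pdivlMr; last first.
      by rewrite (lt_le_trans ltr01)// oneDsqr_ge1.
    by rewrite mulrC ler_pdivrMr ?expR_gt0// HC.
rewrite ge0_integralZl//; last by rewrite lee_fin ltW.
rewrite lte_mul_pinfty ?lee_fin ?(ltW C0)//.
exact: integral_oneDsqrV_lty.
Qed.

Lemma integral_prod_lebesgue_rV_lty n (f : R -> R) :
  measurable_fun setT f -> (forall x, 0 <= f x) ->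
  (\int[lebesgue_measure]_x (f x)%:E < +oo)%E ->
  (\int[lebesgue_rV n]_x (\prod_(i < n) f (x ord0 i))%:E < +oo)%E.
Proof.
move=> mf f0 If; elim: n => [|n IH].
  under eq_integral do rewrite big_ord0.
  by rewrite /= integral_dirac//= diracT mul1e ltry.
have mprod m : measurable_fun setT
    (fun x : 'rV[R]_m => (\prod_(i < m) f (x ord0 i))%:E).
  apply/measurable_EFinP; apply: measurable_prod => i _.
  exact: (measurableT_comp mf (measurable_coord i)).
rewrite /= /lebesgue_rV_step ge0_integral_pushforward//; last 3 first.
- exact: measurable_rV_cons.
- exact: mprod.
- by move=> x _; rewrite lee_fin prodr_ge0.
rewrite preimage_setT.
have E (p : R * 'rV[R]_n) : ((fun x : 'rV[R]_n.+1 =>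
    (\prod_(i < n.+1) f (x ord0 i))%:E) \o @rV_cons R n) p =
    ((f p.1)%:E * (\prod_(i < n) f (p.2 ord0 i))%:E)%E.
  rewrite /= big_ord_recl /rV_cons mxE unlift_none EFinM; congr (_ * _%:E)%E.
  by apply: eq_bigr => i _; rewrite mxE liftK.
under eq_integral do rewrite E.
set J := (\int[lebesgue_rV n]_x _)%E in IH.
have J0 : (0 <= J)%E.
  by apply: integral_ge0 => x _; rewrite lee_fin prodr_ge0.
have mf' : measurable_fun setT (fun x : measurableTypeR R => (f x)%:E).
  exact/measurable_EFinP.
pose F (p : measurableTypeR R * 'rV[R]_n) :=
  ((f p.1)%:E * (\prod_(i < n) f (p.2 ord0 i))%:E)%E.
have mF : measurable_fun setT F.
  apply: emeasurable_funM.
    exact: (measurableT_comp mf' measurable_fst).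
  exact: (measurableT_comp (mprod n) measurable_snd).
have F0 p : (0 <= F p)%E by rewrite mule_ge0 ?lee_fin// prodr_ge0.
rewrite [X in (X < _)%E](_ : _ =
  \int[lebesgue_measure]_x \int[lebesgue_rV n]_v F (x, v))%E; last first.
  exact: (fubini_tonelli1 (m1 := lebesgue_measure) (m2 := lebesgue_rV n) F mF F0).
have inner x : (\int[lebesgue_rV n]_v F (x, v) = (f x)%:E * J)%E.
  rewrite /F /= ge0_integralZl ?lee_fin//; first exact: mprod.
  by move=> v _; rewrite lee_fin prodr_ge0.
under eq_integral do rewrite inner.
rewrite ge0_integralZr//; last by move=> x _; rewrite lee_fin.
have If0 : (0 <= \int[lebesgue_measure]_x (f x)%:E)%E.
  by apply: integral_ge0 => x _; rewrite lee_fin.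
by apply: lte_mul_pinfty => //; rewrite ge0_fin_numE.
Qed.

End integrability.

(** * Membership in the Orlicz class *)

Lemma boltzmannE {R : realType} n (alpha : R) (A : set 'rV[R]_n) :
  measurable A ->
  boltzmann alpha A = (\int[lebesgue_rV n]_(x in A)
    ((fine (boltzmann_Z n alpha))^-1 * expR (- 2 * U_ alpha x))%:E)%E.
Proof.
move=> mA; rewrite /boltzmann -ge0_integralZl//; last 2 first.
- apply/measurable_funTS/measurable_EFinP; apply: measurableT_comp => //.
  by apply: measurable_funM => //; exact: measurable_U_.
- by rewrite lee_fin invr_ge0 fine_ge0// integral_ge0.
Qed.

Lemma semigroup_expUE {R : realType} n d (Omega : measurableType d)
    (P : 'rV[R]_n -> probability Omega R) (X : R -> Omega -> 'rV[R]_n)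
    (alpha t : R) x :
  semigroup P X alpha t (fun z => expR (U_ alpha z)) x =
  ((expR (U_ alpha x))%:E *
   \int[P x]_w (feynman_kac_weight X (U_ alpha) t w)%:E)%E.
Proof.
rewrite /semigroup unlock; congr (_ * _)%E; apply: eq_integral => w _.
by rewrite -expRD subrr expR0 mul1r.
Qed.

Section young.
Context {R : realType} (tau psi : R -> R).

Lemma young_ge0 : young_function tau ->
  (forall y, 0 < y -> tau y = y ^+ 2 * psi y) -> (forall y, 0 < y -> 0 < psi y) ->
  forall y, 0 <= tau y.
Proof.
move=> [_ tauN _ tau0] tauE psi0 y.
wlog y0 : y / 0 <= y => [H|].
  by have [/H//|y0] := leP 0 y; rewrite -tauN H// oppr_ge0 ltW.
move: y0; rewrite le_eqVlt => /predU1P[<-|y0]; first by rewrite tau0.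
by rewrite tauE// mulr_ge0 ?sqr_ge0// ltW// psi0.
Qed.

End young.

Lemma U_le {R : realType} n (alpha : R) (x : 'rV[R]_n) : 1 < alpha -> alpha < 2 ->
  U_ alpha x <= \sum_(i < n) `|x ord0 i| `^ alpha + 2 * n%:R.
Proof.
move=> alpha1 alpha2; rewrite mulr_natr -[X in _ *+ X](card_ord n) -sumr_const.
by rewrite -big_split/=; apply: ler_sum => i _; exact: u_le.
Qed.

(** With $H=e^UE$, the factor $H^2$ in $\tau(H)=H^2\psi(H)$ cancels the density
    $e^{-2U}$, while $\psi(H)\le\psi(e^{\sum_i|x_i|^\alpha+c})$ is controlled by
    the growth of $\psi$. The sum over the coordinates is taken out of the power
    $y\mapsto y^{2(\alpha-1)/\alpha}$ by subadditivity. *)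
Lemma young_density_le {R : realType} n (alpha t a b K C y0 : R)
    (tau psi : R -> R) : 1 < alpha -> alpha < 2 -> 0 < t -> 0 < b -> 0 < K ->
  young_function tau ->
  (forall y, 0 < y -> tau y = y ^+ 2 * psi y) ->
  (forall y, 0 < y -> 0 < psi y) ->
  (forall x y, 0 < x -> x <= y -> psi x <= psi y) ->
  (forall y, y0 <= y -> 0 <= y ->
     psi (expR y) <= C * expR (b * t * y `^ (2 * (alpha - 1) / alpha))) ->
  exists D : R, 0 <= D /\ forall (x : 'rV[R]_n) (E : R), 0 <= E ->
    E <= K * expR (- (2^-1 * t * a *
           \sum_(i < n) `|x ord0 i| `^ (2 * (alpha - 1)))) -> 0 < a ->
    tau (expR (U_ alpha x) * E) * expR (- 2 * U_ alpha x) <=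
    D * \prod_(i < n) expR (- ((a - b) * t * `|x ord0 i| `^ (2 * (alpha - 1)))).
Proof.
move=> alpha1 alpha2 t0 b0 K0 ty tauE psi0 psimono Hpsi.
have alpha0 : 0 < alpha by rewrite (lt_trans ltr01).
set be := 2 * (alpha - 1) in Hpsi *; pose g := be / alpha.
have be0 : 0 < be by rewrite /be; lra.
have g0 : 0 < g by rewrite divr_gt0.
have g1 : g <= 1 by rewrite ler_pdivrMr// mul1r /be; lra.
(* [c] absorbs the constants of [U_le] and of the decay estimate, and brings the
   argument of psi beyond the threshold [y0] *)
pose c := 2 * n%:R + `|ln K| + `|y0|.
have n2 : 0 <= 2 * n%:R :> R by rewrite mulr_ge0.
have c0 : 0 <= c by rewrite !addr_ge0.
have C0 : 0 <= C.
  have [_ h] := (ler_norm y0, Hpsi `|y0| (ler_norm y0) (normr_ge0 y0)).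
  have := le_trans (ltW (psi0 _ (expR_gt0 `|y0|))) h.
  by rewrite pmulr_lge0// expR_gt0.
have D0 : 0 <= K ^+ 2 * C * expR (b * t * c `^ g).
  by apply: mulr_ge0; [apply: mulr_ge0 => //; exact: sqr_ge0|exact: expR_ge0].
exists (K ^+ 2 * C * expR (b * t * c `^ g)); split => //.
move=> x E E0 EK a0; rewrite -expR_sum.
have [->|En0] := eqVneq E 0.
  have [_ _ _ tau0] := ty; rewrite mulr0 tau0 mul0r.
  by rewrite mulr_ge0 ?expR_ge0.
have Egt0 : 0 < E by rewrite lt_def En0.
have H0 : 0 < expR (U_ alpha x) * E by rewrite mulr_gt0 ?expR_gt0.
set S := \sum_(i < n) `|x ord0 i| `^ be in EK *.
have S0 : 0 <= S by apply: sumr_ge0 => i _; exact: powR_ge0.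
set Sa := \sum_(i < n) `|x ord0 i| `^ alpha.
have Sa0 : 0 <= Sa by apply: sumr_ge0 => i _; exact: powR_ge0.
have HS : expR (U_ alpha x) * E <= expR (Sa + c).
  have EK' : E <= expR (ln K).
    rewrite lnK ?posrE// (le_trans EK)// ler_piMr ?(ltW K0)//.
    rewrite -[leRHS]expR0 ler_expR oppr_le0 mulr_ge0// !mulr_ge0 ?(ltW a0)//.
    exact: ltW.
  rewrite (le_trans (ler_wpM2l (expR_ge0 _) EK'))// -expRD ler_expR.
  have := @U_le _ _ alpha x alpha1 alpha2; rewrite -/Sa => hU.
  have h1 := ler_norm (ln K); have h2 := normr_ge0 y0.
  by rewrite /c; lra.
have psiH : psi (expR (U_ alpha x) * E) <=
    C * expR (b * t * S + b * t * c `^ g).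
  apply: (le_trans (psimono _ _ H0 HS)).
  apply: (le_trans (Hpsi _ _ _)).
  - have h1 := ler_norm y0; have h2 := normr_ge0 (ln K).
    by rewrite /c; lra.
  - exact: addr_ge0.
  - rewrite ler_wpM2l// ler_expR -mulrDr ler_wpM2l ?mulr_ge0 ?(ltW b0) ?(ltW t0)//.
    apply: le_trans (powR_subadd _ _ _) _ => //; first by rewrite (ltW g0).
    rewrite lerD2r.
    apply: (le_trans (powR_subadd_sum _ _ _)); first by rewrite g0.
      by move=> i; exact: powR_ge0.
    apply: ler_sum => i _.
    by rewrite -powRrM /g mulrC divfK ?gt_eqF.
rewrite tauE// exprMn -expRM_natl.
have E2 : E ^+ 2 <= K ^+ 2 * expR (- (t * a * S)).
  apply: (@le_trans _ _ ((K * expR (- (2^-1 * t * a * S))) ^+ 2)).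
    by rewrite ler_sqr ?nnegrE// mulr_ge0 ?expR_ge0// ltW.
  rewrite exprMn -expRM_natl; apply: ler_wpM2l; first exact: sqr_ge0.
  by rewrite ler_expR; rewrite le_eqVlt; apply/orP; left; apply/eqP; field.
have -> : expR (2 * U_ alpha x) * E ^+ 2 * psi (expR (U_ alpha x) * E) *
    expR (- 2 * U_ alpha x) = E ^+ 2 * psi (expR (U_ alpha x) * E).
  have cancel (u v e p : R) : u * v = 1 -> u * e * p * v = e * p.
    move=> uv; have -> : u * e * p * v = u * v * (e * p) by ring.
    by rewrite uv mul1r.
  by apply: cancel; rewrite -expRD mulNr subrr expR0.
have step := ler_pM (sqr_ge0 E) (ltW (psi0 _ H0)) E2 psiH.
apply: (le_trans step).
rewrite sumrN -mulr_sumr -/S.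
have -> : K ^+ 2 * expR (- (t * a * S)) * (C * expR (b * t * S + b * t * c `^ g)) =
  K ^+ 2 * C * (expR (- (t * a * S)) * expR (b * t * S + b * t * c `^ g)) by ring.
rewrite -expRD -[leRHS]mulrA -expRD; apply: ler_wpM2l.
  by rewrite mulr_ge0// sqr_ge0.
by rewrite ler_expR; rewrite le_eqVlt; apply/orP; left; apply/eqP; ring.
Qed.

Theorem theorem1 (R : realType) (alpha t : R) (tau psi : R -> R)
    (alpha_gt1 : 1 < alpha) (alpha_lt2 : alpha < 2) (t_gt0 : 0 < t)
    (tau_young : young_function tau)
    (tauE : forall y, 0 < y -> tau y = y ^+ 2 * psi y)
    (psi_gt0 : forall y, 0 < y -> 0 < psi y)
    (psi_nondecreasing : forall x y, 0 < x -> x <= y -> psi x <= psi y)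
    (psi_pinfty : psi y @[y --> +oo] --> +oo)
    (psi_doubling : exists k : R, forall y, 0 < y -> psi (2 * y) <= k * psi y)
    (n : nat) (n_gt0 : (0 < n)%N)
    (d : measure_display) (Omega : measurableType d)
    (P : 'rV[R]_n -> probability Omega R) (X : R -> Omega -> 'rV[R]_n)
    (X_brownian : forall x, brownian_motion (P x) X x)
    (psi_integrable : exists d_alpha : R, d_alpha < alpha ^+ 2 /\
      exists A : R, lebesgue_measure.-integrable `[A, +oo[
        (fun x => (psi (expR (`|x| `^ alpha)) *
           expR (- d_alpha * t * `|x| `^ (2 * (alpha - 1))))%:E)) :
  L_ (boltzmann alpha) tau
    (semigroup P X alpha t (fun x => expR (U_ alpha x))).
Proof.
have [d_alpha [d_lt [A iA]]] := psi_integrable.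
have [b [C [y0 [b0 balpha Hpsi]]]] := psi_expR_le alpha_gt1 alpha_lt2 t_gt0 d_lt
  psi_gt0 psi_nondecreasing iA.
pose a := (b + alpha ^+ 2) / 2.
have ab : b < a by rewrite /a; lra.
have aalpha : a < alpha ^+ 2 by rewrite /a; lra.
have a0 : 0 < a by exact: lt_trans ab.
have [K [K0 HK]] := weight_expectation_le X alpha_gt1 alpha_lt2 t_gt0 n_gt0 a0 aalpha.
have [D [D0 HD]] := young_density_le n a alpha_gt1 alpha_lt2 t_gt0 b0 K0
  tau_young tauE psi_gt0 psi_nondecreasing Hpsi.
pose e x := (\int[P x]_w (feynman_kac_weight X (U_ alpha) t w)%:E)%E.
have e0 x : (0 <= e x)%E by apply: integral_ge0 => w _; rewrite lee_fin expR_ge0.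
have eK x := HK (P x) x (X_brownian x).
have efin x : e x = (fine (e x))%:E.
  by rewrite fineK// ge0_fin_numE// (le_lt_trans (eK x))// ltry.
have me : measurable_fun setT e by exact: measurable_weight_expectation.
have mU : measurable_fun setT (fun x : 'rV[R]_n => expR (U_ alpha x)).
  by apply: measurableT_comp => //; exact: measurable_U_.
pose H x := expR (U_ alpha x) * fine (e x).
have hE : semigroup P X alpha t (fun x => expR (U_ alpha x)) = EFin \o H.
  by apply/funext => x; rewrite semigroup_expUE -/(e x) efin -EFinM.
have mH : measurable_fun setT H.
  by apply: measurable_funM => //; exact: measurableT_comp.
rewrite hE; split; first exact/measurable_EFinP.
have [ctau _ _ _] := tau_young.
have tau_ge0 := young_ge0 tau_young tauE psi_gt0.
pose z := (fine (boltzmann_Z n alpha))^-1.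
have z0 : 0 <= z.
  by rewrite invr_ge0 fine_ge0// integral_ge0.
have mg : measurable_fun setT (fun x : 'rV[R]_n => z * expR (- 2 * U_ alpha x)).
  apply: measurable_funM => //; apply: measurableT_comp => //.
  by apply: measurable_funM => //; exact: measurable_U_.
have mtau : measurable_fun setT (fun x => (tau (H x))%:E).
  apply/measurable_EFinP; apply: (measurableT_comp _ mH).
  exact: continuous_measurable_fun.
rewrite (ge0_integral_density (mu := lebesgue_rV n) mg _ (@boltzmannE R n alpha)
  mtau); last 2 first.
- by move=> x; rewrite mulr_ge0 ?expR_ge0.
- by move=> x; rewrite lee_fin.
pose f (y : R) := expR (- ((a - b) * t * `|y| `^ (2 * (alpha - 1)))).
have mf : measurable_fun setT f.
  apply: measurableT_comp => //; apply: measurableT_comp => //.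
  by apply: measurable_funM => //; exact: (measurableT_comp (measurable_powR _)).
have mprod : measurable_fun setT
    (fun x : 'rV[R]_n => (\prod_(i < n) f (x ord0 i))%:E).
  apply/measurable_EFinP; apply: measurable_prod => i _.
  exact: (measurableT_comp mf (measurable_coord i)).
apply: (@le_lt_trans _ _ (\int[lebesgue_rV n]_x
    ((z * D)%:E * (\prod_(i < n) f (x ord0 i))%:E))%E).
  apply: ge0_le_integral => //.
  - by move=> x _; rewrite mule_ge0 ?lee_fin// mulr_ge0 ?expR_ge0.
  - by apply: emeasurable_funM => //; exact/measurable_EFinP.
  - exact: measurable_funeM.
  - move=> x _; rewrite -!EFinM lee_fin mulrCA -[leRHS]mulrA ler_wpM2l//.
    apply: HD => //; first exact: fine_ge0.
    by rewrite -lee_fin -efin; exact: eK.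
rewrite ge0_integralZl//; last 2 first.
- by move=> x _; rewrite lee_fin prodr_ge0// => i _; exact: expR_ge0.
- by rewrite lee_fin mulr_ge0.
rewrite lte_mul_pinfty ?lee_fin ?mulr_ge0//.
apply: integral_prod_lebesgue_rV_lty => //.
- by move=> y; exact: expR_ge0.
- by apply: integral_expRN_powR_lty; [rewrite mulr_gt0 ?subr_gt0|lra].
Qed.
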